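(* Let $n\ge 0$ be an integer and let $X$ be a proper metric space with $\mathrm{asdim}\, X\le n$. Then there exist locally finite binary regular trees $T^0,\dots,T^n$ (each equipped with a filtration witnessing binary regularity) such that there is a large scale embedding of $X$ into $M(T^0,\dots,T^n)$.
   Context: A metric space is proper if its closed balls are compact. Finite products of metric spaces carry the sup-metric. Asymptotic dimension: $\mathrm{asdim}\, X\le n$ if for every $D>0$ there is a uniformly bounded cover $\mathcal U$ of $X$ (diameters of members bounded by a common constant) with $\mathcal U=\mathcal U^0\cup\dots\cup\mathcal U^n$, where each $\mathcal U^i$ is $D$-disjoint (distinct members are at distance at least $D$). Large scale embedding: a map $f\colon X\to Y$ for which there exist increasing functions $\varphi_1,\varphi_2\colon[0,\infty)\to[0,\infty)$ tending to $\infty$ at $\infty$ with $\varphi_1(d(x,y))\le d(f(x),f(y))\le\varphi_2(d(x,y))$ for all $x,y\in X$. Trees: An $\mathbb R$-tree is a geodesic metric space $T$ in which any two points $x,y$ are joined by a unique geodesic segment $[x,y]$, and $[x,y]\cap[y,z]=\{y\}$ implies $[x,y]\cup[y,z]=[x,z]$. A tree is a connected acyclic graph with the geodesic metric in which each edge is isometric to the unit segment; it is an $\mathbb R$-tree. An open or half-open segment in $T$ is free if it is an open subset of $T$. The mesh of $T$ is the infimum of the diameters of the maximal (with respect to inclusion) free open or half-open segments in $T$. An $\mathbb R$-tree $T$ is regular if there is a sequence (filtration) of $\mathbb R$-trees $T=T_0\supset T_1\supset T_2\supset\dots$ such that: (1) $\bigcap_i T_i=\emptyset$; (2) for every $i$,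 $T_i\setminus T_{i+1}$ is a disjoint union of a uniformly bounded family of maximal free in $T_i$ half-open segments; (3) $D_0<D_1<D_2<\dots$ and $\lim_i D_i=\infty$, where $D_i$ is the mesh of $T_i$. It is binary regular if moreover $D_i=2^i$ for all $i$. The canonical retraction $r_j\colon T\to T_j$ sends each component $C$ of $T\setminus T_j$ to its boundary $\partial C$ (a single point). Given regular $\mathbb R$-trees $T^{(0)},\dots,T^{(n)}$ with filtrations $(T^{(i)}_j)_{j\ge0}$ and canonical retractions $r^{(i)}_j\colon T^{(i)}\to T^{(i)}_j$, put for $j\ge1$ $$M_j=\Big\{(x_0,\dots,x_n)\in\prod_{i=0}^nT^{(i)}\ :\ \exists i,\ r^{(i)}_j(x_i)\in\partial\big(T^{(i)}_{j-1}\setminus T^{(i)}_j\big)\Big\},$$ where the boundary is taken in $T^{(i)}_{j-1}$, and $M(T^{(0)},\dots,T^{(n)})=\bigcap_{j=1}^\infty M_j$ with the metric induced from the product. *)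

(* Defs.v *)
From HB Require Import structures.
From mathcomp Require Import all_boot all_order all_algebra.
From mathcomp Require Import all_classical all_reals all_analysis.

Set Implicit Arguments.
Unset Strict Implicit.
Unset Printing Implicit Defensive.

Import Order.TTheory GRing.Theory Num.Theory.
Import numFieldNormedType.Exports.

Local Open Scope classical_set_scope.
Local Open Scope ring_scope.

Section MetricNotions.
Context {R : realType} {X : metricType R}.
Implicit Types (A S : set X) (F : set (set X)).

(* The library's [closed_ball] is the closure of the open ball, which may be
   smaller than [set y | mdist x y <= r]. *)
Definition proper_space : Prop :=
  forall (x : X) (r : R), compact [set y | mdist x y <= r].

Definition ediam S : \bar R :=
  ereal_sup [set (mdist x y)%:E | x in S & y in S]%classic.

Definition uniformly_bounded F : Prop :=
  exists r : R, forall S, F S -> forall x y, S x -> S y -> mdist x y <= r.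

Definition D_disjoint (D : R) F : Prop :=
  forall A B, F A -> F B -> A <> B ->
    forall a b, A a -> B b -> D <= mdist a b.

Definition asdim_le (n : nat) : Prop :=
  forall D : R, 0 < D ->
    exists U : 'I_n.+1 -> set (set X),
      [/\ uniformly_bounded (\bigcup_i U i),
          \bigcup_(A in \bigcup_i U i) A = setT
        & forall i, D_disjoint D (U i)].

(* Subspaces are represented by sets: the two notions below are relative to
   the subspace [A] (with [S `<=` A]). *)
Definition open_in A S : Prop := exists2 U, open U & S = U `&` A.

Definition boundary_in A S : set X := A `&` closure S `&` closure (A `\` S).

End MetricNotions.
Arguments proper_space {R} X.
Arguments asdim_le {R} X n.

(* "Increasing" is meant in the weak sense, as usual for large scale (coarse)
   embeddings; a strictly increasing [phi1] would force [f] to be injective.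
   The functions on [0, +oo[ are total functions constrained on [0, +oo[. *)
Definition large_scale_control {R : realType} (phi : R -> R) : Prop :=
  [/\ forall t : R, 0 <= t -> 0 <= phi t,
      {in `[0, +oo[ &, nondecreasing_fun phi}
    & phi t @[t --> +oo] --> +oo].

Definition large_scale_embedding {R : realType} {X Y : Type}
    (dX : X -> X -> R) (dY : Y -> Y -> R) (f : X -> Y) : Prop :=
  exists phi1 phi2 : R -> R,
    [/\ large_scale_control phi1, large_scale_control phi2
      & forall x y, phi1 (dX x y) <= dY (f x) (f y) <= phi2 (dX x y)].

Definition sup_dist {R : realType} {n : nat} {T : 'I_n.+1 -> metricType R}
    (x y : forall i, T i) : R :=
  \big[Num.max/0]_(i < n.+1) mdist (x i) (y i).

Section RTrees.
Context {R : realType} {T : metricType R}.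
Implicit Types (A S I : set T) (x y z : T).

Definition geodesic_segment A x y S : Prop :=
  exists g : R -> T,
    [/\ g 0 = x, g (mdist x y) = y,
        {in `[0, mdist x y] &, forall s t, mdist (g s) (g t) = `|s - t|},
        S = g @` `[0, mdist x y]%classic
      & S `<=` A].

Definition rtree A : Prop :=
  (forall x y, A x -> A y -> exists! S, geodesic_segment A x y S) /\
  (forall x y z S1 S2, geodesic_segment A x y S1 -> geodesic_segment A y z S2 ->
     S1 `&` S2 = [set y] -> geodesic_segment A x z (S1 `|` S2)).

Definition open_segment A S : Prop :=
  exists x y I, [/\ x <> y, geodesic_segment A x y I & S = I `\` [set x; y]].

Definition half_open_segment A S : Prop :=
  exists x y I, [/\ x <> y, geodesic_segment A x y I & S = I `\ y].

Definition free_segment A S : Prop :=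
  (open_segment A S \/ half_open_segment A S) /\ open_in A S.

Definition max_free_segment A S : Prop :=
  free_segment A S /\
  forall S', free_segment A S' -> S `<=` S' -> S' = S.

(* The infimum is taken in [\bar R]; it is [+oo] if there is no maximal free
   segment. *)
Definition mesh A : \bar R := ereal_inf [set ediam S | S in max_free_segment A].

Record regular_filtration (F : nat -> set T) : Prop := RegularFiltration {
  filtration0 : F 0%N = setT ;
  filtrationS : forall i, F i.+1 `<=` F i ;
  filtration_rtree : forall i, rtree (F i) ;
  filtration_bigcap : \bigcap_i F i = set0 ;
  filtration_diff : forall i, exists C : set (set T),
    [/\ forall S, C S -> max_free_segment (F i) S /\ half_open_segment (F i) S,
        trivIset C id, uniformly_bounded C
      & F i `\` F i.+1 = \bigcup_(S in C) S] ;
  mesh_increasing : forall i, (mesh (F i) < mesh (F i.+1))%E ;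
  mesh_cvg : mesh (F i) @[i --> \oo] --> +oo%E }.

Definition binary_regular_filtration (F : nat -> set T) : Prop :=
  regular_filtration F /\ forall i, mesh (F i) = (2 ^+ i)%:E.

(* Canonical retraction onto [A]. The default value [x] of [xget] is only used
   when the boundary of the component of [x] is not a singleton, which does not
   happen for the members of a regular filtration. *)
Definition canonical_retraction A x : T :=
  if x \in A then x
  else xget x [set y |
    boundary_in setT (connected_component (~` A) x) = [set y]].

End RTrees.

Section CombinatorialTrees.
Context {V : choiceType} (adj : rel V).

Definition connected_graph : Prop :=
  forall u v, exists2 p, path adj u p & last u p = v.

Definition acyclic_graph : Prop :=
  forall c : seq V, (2 < size c)%N -> ~ ucycle adj c.

Definition tree_graph : Prop :=
  [/\ symmetric adj, irreflexive adj, connected_graph & acyclic_graph].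

Definition locally_finite_graph : Prop :=
  forall u, finite_set [set v | adj u v].

End CombinatorialTrees.

Section Realization.
Context {R : realType} {V : choiceType} (adj : rel V) {T : metricType R}.
Variables (vtx : V -> T) (edg : V -> V -> R -> T).

Definition on_common_edge (x y : T) : Prop :=
  exists u v (s t : R), [/\ adj u v, s \in `[0, 1], t \in `[0, 1],
                      x = edg u v s & y = edg u v t].

(* [chain x y l]: there is a chain of points from [x] to [y], consecutive points
   lying on a common closed edge, of total length [l]. *)
Inductive chain : T -> T -> R -> Prop :=
| chain_nil x : chain x x 0
| chain_cons x y z l :
    on_common_edge x y -> chain y z l -> chain x z (mdist x y + l).

(* [T] is the geometric realization of the graph [(V, adj)], with the path
   metric for which edges are isometric to the unit segment; [edg u v]
   parametrizes the edge [uv] from [u] to [v]. *)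
Record geometric_realization : Prop := GeometricRealization {
  vtx_inj : injective vtx ;
  edg0 : forall u v, adj u v -> edg u v 0 = vtx u ;
  edg_rev : forall u v (t : R), adj u v -> t \in `[0, 1] ->
    edg v u t = edg u v (1 - t) ;
  edg_isometric : forall u v, adj u v ->
    {in `[0, 1] &, forall s t, mdist (edg u v s) (edg u v t) = `|s - t|} ;
  realization_cover : forall x : T,
    (exists v, x = vtx v) \/
    (exists u v (t : R), [/\ adj u v, t \in `[0, 1] & x = edg u v t]) ;
  edg_vtx_disjoint : forall u v w (t : R), adj u v -> t \in `]0, 1[ ->
    edg u v t <> vtx w ;
  edg_disjoint : forall u v u' v' (s t : R), adj u v -> adj u' v' ->
    s \in `]0, 1[ -> t \in `]0, 1[ -> edg u v s = edg u' v' t ->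
    (u = u' /\ v = v') \/ (u = v' /\ v = u') ;
  path_metric : forall x y, mdist x y = inf [set l | chain x y l] }.

End Realization.

Definition locally_finite_tree {R : realType} (T : metricType R) : Prop :=
  exists (V : choiceType) (adj : rel V),
    [/\ tree_graph adj, locally_finite_graph adj
      & exists (vtx : V -> T) (edg : V -> V -> R -> T),
          geometric_realization adj vtx edg].

Definition M_level {R : realType} {n : nat} {T : 'I_n.+1 -> metricType R}
    (F : forall i, nat -> set (T i)) (j : nat) : set (forall i, T i) :=
  [set x | exists i, boundary_in (F i j.-1) (F i j.-1 `\` F i j)
                       (canonical_retraction (F i j) (x i))].

Definition M_space {R : realType} {n : nat} {T : 'I_n.+1 -> metricType R}
    (F : forall i, nat -> set (T i)) : set (forall i, T i) :=
  \bigcap_(j in [set j | (1 <= j)%N]) M_level F j.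

(* Main.v *)
From HB Require Import structures.
Require Import Defs.
From mathcomp Require Import all_boot all_order all_algebra.
From mathcomp Require Import all_classical all_reals all_analysis.
From mathcomp Require Import zify ring lra.

(** The trees.  A tree is rooted at infinity, with a height function; a branch of
    level k is a vertical segment of length 2 ^ k that hangs from a point of some
    branch of higher level, at a height which is an odd multiple of 2 ^ k.  A point
    is coded by its height and by the labels of the branches through which one
    passes when ascending from it, one label at most for each level; the binary
    digits of the height tell which levels can occur.  The k-th stratum consists of
    the points that lie on no branch of level less than k.  All its edges have
    length 2 ^ k, and the next stratum arises by removing the edges of level k, so
    the strata form a binary regular filtration ([stratum_binary_regular]): a free
    segment cannot contain a node, hence it stays in one edge ([free_sub_edge]).
    Distances are given by the heights at which ascending lines merge; these form
    an ultrametric, which yields the four point condition and from it the R-tree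
    axioms ([four_point_rtree]).  The canonical retraction follows the ascending
    line, so a family of points belongs to the space M as soon as, for every level
    k, one of its members has a label on level k ([tree_M_space]).

    The map.  Choose scales E 0, E 1, ... that increase very fast, and for each
    scale q a cover of X by n + 1 families, one for each colour, of uniformly
    bounded sets at mutual distance at least 2 (E q) ([scales_ex]).  For one
    colour, a map to the tree is built from the large scales down to the small
    ones.  Suppose that the map into the stratum 2q + 2 has been found, with a
    Lipschitz constant so small that a member C of the family of scale q, together
    with its collar of width E q, is mapped into a ball of radius 1/4.  Then all of
    this image can be pushed up to one point of the tree, the roof of C, from which
    a new branch with label C is hung; the new map sends C to the lower end of that
    branch and interpolates in the collar.  It moves points by at most a multiple
    of 2 ^ (2q), so it is Lipschitz with a small constant if E q is large
    ([step_good]).  To start at infinity, one member of each family is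
    made to contain a large ball around a base point and is given the base label;
    then the result is locally eventually independent of the scale at which the
    construction starts ([tower_stable]).

    The two properties.  Steps of smaller scales push points up again, but only to
    heights at which branches of smaller level can hang; they never push a point
    of C above the branch of C ([tower_under]).  As the members of all colours
    cover X at every scale, every point has a label on every level in one colour,
    which is membership in M.  If x lies in C and y lies outside of the collar of
    C, the line from y does not run through the branch of C, whose roof is at
    distance at least 2 ^ (2q) from the image of x ([limit_far]): far away points
    have images at large distance.  Local finiteness holds because, base
    labels aside, only labels with intersecting collars occur on one line, and in a
    proper space a bounded set meets finitely many members of a separated family ([adjacent_finite]). *)

Set Implicit Arguments.
Unset Strict Implicit.
Unset Printing Implicit Defensive.

Import Order.TTheory GRing.Theory Num.Theory.
Import numFieldNormedType.Exports.

Local Open Scope classical_set_scope.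
Local Open Scope ring_scope.

(** * Dyadic blocks of the half-line *)

Section Blocks.
Context {R : realType}.
Implicit Types (s t u : R) (i j k : nat) (m : int).

(** The number of the dyadic block of length 2 ^ k that contains t. *)
Definition blk k t : int := Num.floor (t / 2 ^+ k).

(** For t >= 0: the binary digit of weight 2 ^ k of t is 0. *)
Definition digit0 k t : Prop := blk k t = blk k.+1 t * 2.

Lemma exp2_gt0 k : 0 < 2 ^+ k :> R.
Proof. by rewrite exprn_gt0. Qed.
Hint Resolve exp2_gt0 : core.

Lemma exp2_ge1 k : 1 <= 2 ^+ k :> R.
Proof. by rewrite exprn_ege1 // ler1n. Qed.

Lemma blkP k t m : (blk k t = m) <-> (m%:~R * 2 ^+ k <= t < (m + 1)%:~R * 2 ^+ k).
Proof.
rewrite -ler_pdivlMr // -ltr_pdivrMr // -floor_eq.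
by split=> [<-|/eqP].
Qed.

Lemma blk_itv k t : (blk k t)%:~R * 2 ^+ k <= t < (blk k t + 1)%:~R * 2 ^+ k.
Proof. exact/blkP. Qed.

Lemma blk_ge k t m : (m <= blk k t) = (m%:~R * 2 ^+ k <= t).
Proof. by rewrite /blk floor_ge_int ler_pdivlMr. Qed.

Lemma blk_lt k t m : (blk k t < m) = (t < m%:~R * 2 ^+ k).
Proof. by rewrite /blk floor_lt_int ltr_pdivrMr. Qed.

Lemma le_blk k s t : s <= t -> blk k s <= blk k t.
Proof. by move=> st; apply: le_floor; rewrite ler_pM2r // invr_gt0. Qed.

Lemma blk_ge0 k t : 0 <= t -> 0 <= blk k t.
Proof. by move=> t0; rewrite blk_ge mul0r. Qed.

Lemma dyadicM i j m : (i <= j)%N ->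
  m%:~R * 2 ^+ j = (m * 2 ^+ (j - i))%:~R * 2 ^+ i :> R.
Proof.
move=> ij; rewrite intrM rmorphXn /= -mulrA -exprD subnK //.
Qed.

Lemma eq_blk i k s t : (i <= k)%N -> blk i s = blk i t -> blk k s = blk k t.
Proof.
move=> ik e; apply/blkP.
have /andP[] := blk_itv k t.
rewrite 2!(dyadicM _ ik) -blk_ge -blk_lt -e blk_ge blk_lt => -> ->//.
Qed.

Lemma blk_div2 k t : blk k.+1 t * 2 <= blk k t < blk k.+1 t * 2 + 2.
Proof.
have /andP[h1 h2] := blk_itv k.+1 t.
rewrite blk_ge blk_lt; move: h1 h2; rewrite exprS !intrD !intrM => h1 h2.
by apply/andP; split; lra.
Qed.

Lemma eq_digit0 i k s t : (i <= k)%N -> blk i s = blk i t -> digit0 k t -> digit0 k s.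
Proof.
by move=> ik e; rewrite /digit0 (eq_blk ik e) (eq_blk (leqW ik) e).
Qed.

Lemma digit0_gap k t : digit0 k t -> t + 2 ^+ k < (blk k.+1 t + 1)%:~R * 2 ^+ k.+1.
Proof.
move=> d; have /andP[_] := blk_itv k t; rewrite d exprS !intrD !intrM; lra.
Qed.

Lemma blk_mul k m : blk k (m%:~R * 2 ^+ k) = m.
Proof. by apply/blkP; rewrite lexx /= ltr_pM2r // ltr_int; lia. Qed.

Lemma blk_odd j m s : (m * 2 + 1)%:~R * 2 ^+ j - 2 ^+ j <= s < (m * 2 + 1)%:~R * 2 ^+ j ->
  blk j s = m * 2 /\ blk j.+1 s = m.
Proof.
move=> /andP[h1 h2]; move: h1 h2; rewrite !intrD !intrM => h1 h2.
by split; apply/blkP; rewrite ?exprS !intrD ?intrM; apply/andP; split; have := exp2_gt0 j; lra.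
Qed.

End Blocks.
#[global] Hint Resolve exp2_gt0 : core.

(** * A tree of labelled points *)

Section RawTree.
Context {R : realType} {L : Type}.
Variable base : nat -> L.

(** A point is given by its height and, for every level k, by the label of the
    branch of level k that the ascending line from the point runs through, or by
    None if the line avoids that level. *)
Record lpoint := LPoint { ht : R ; lab : nat -> option L }.

Implicit Types (x y z w : lpoint) (u v s : R) (k : nat).

(** The line that ascends from x leaves its branch of level k at the first
    multiple of 2 ^ k above ht x, so the labels that survive at height u are those
    of the levels whose block has not changed. *)
Definition mask x u k := if blk k u == blk k (ht x) then lab x k else None.

Definition anc x u := let h := Num.max (ht x) u in LPoint h (mask x h).

(** A branch of level k occupies a dyadic block whose digit of weight 2 ^ k is 0;
    it therefore hangs from an odd multiple of 2 ^ k, and branches of different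
    levels hang from different points.  As the labels are eventually the base
    labels, any two ascending lines merge. *)
Definition proper_point x :=
  [/\ 0 <= ht x, forall k, lab x k <> None -> digit0 k (ht x)
    & exists N, forall k, (N <= k)%N -> lab x k = Some (base k)].

Lemma pointP x y : ht x = ht y -> lab x =1 lab y -> x = y.
Proof. by case: x y => [s a] [t b] /= -> /funext ->. Qed.

Lemma ht_anc x u : ht x <= u -> ht (anc x u) = u.
Proof. by move=> xu; rewrite /= max_r. Qed.

Lemma lab_anc x u : ht x <= u -> lab (anc x u) = mask x u.
Proof. by move=> xu; rewrite /= max_r. Qed.

Lemma mask_ht x : mask x (ht x) =1 lab x.
Proof. by move=> k; rewrite /mask eqxx. Qed.

Lemma anc_le x u : u <= ht x -> anc x u = x.
Proof. by move=> ux; apply: pointP; rewrite /= max_l //; exact: mask_ht. Qed.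

Lemma mask_mask x u v k : ht x <= u -> u <= v ->
  mask x v k = if blk k v == blk k u then mask x u k else None.
Proof.
move=> xu uv; rewrite /mask.
have := le_blk k xu; have := le_blk k uv.
case: (blk k v =P blk k u) => [->//|vu].
by case: eqP => // ex *; exfalso; apply: vu; lia.
Qed.

Lemma anc_anc x u v : u <= v -> anc (anc x u) v = anc x v.
Proof.
move=> uv; have e : Num.max (Num.max (ht x) u) v = Num.max (ht x) v.
  by rewrite -maxA (max_r uv).
apply: pointP => [|k]; rewrite /= e //.
rewrite (@mask_mask x (Num.max (ht x) u)) //.
  by rewrite le_max lexx.
by rewrite ge_max !le_max lexx uv orbT.
Qed.

Lemma mask_block x i u k : (i <= k)%N -> blk i u = blk i (ht x) -> mask x u k = lab x k.
Proof. by move=> ik e; rewrite /mask (eq_blk ik e) eqxx. Qed.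

Lemma proper_anc x u : proper_point x -> proper_point (anc x u).
Proof.
move=> [x0 xd [N xN]]; set h := Num.max (ht x) u.
have xh : ht x <= h by rewrite le_max lexx.
split.
- exact: le_trans xh.
- move=> k /=; rewrite -/h /mask; case: eqP => // e /xd.
  exact: eq_digit0 (leqnn k) e.
- have [m hm] : exists m : nat, h < 2 ^+ m.
    exists (Num.bound h); apply: (lt_trans (archi_boundP (le_trans x0 xh))).
    by rewrite -natrX ltr_nat ltn_expl.
  exists (maxn N m) => k; rewrite geq_max => /andP[Nk mk] /=; rewrite -/h /mask.
  have small (t : R) : 0 <= t -> t < 2 ^+ m -> blk k t = 0.
    move=> t0 tm; apply/blkP; rewrite mul0r t0 add0r mul1r (lt_le_trans tm) //.
    by rewrite ler_eXn2l // ltr1n.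
  by rewrite !small ?xN ?(le_lt_trans xh) // (le_trans x0).
Qed.

Definition meets x y u := [/\ ht x <= u, ht y <= u & mask x u =1 mask y u].

Definition meet_ht x y := inf [set u | meets x y u].

(** The length of the path that ascends from x to the merging point and then
    descends to y. *)
Definition tdist x y := meet_ht x y * 2 - ht x - ht y.

Lemma meets_sym x y u : meets x y u -> meets y x u.
Proof. by case=> ? ? e; split=> // k. Qed.

Lemma meets_up x y u v : meets x y u -> u <= v -> meets x y v.
Proof.
move=> [xu yu e] uv; split; [exact: le_trans uv|exact: le_trans uv|move=> k].
by rewrite (mask_mask _ xu uv) (mask_mask _ yu uv) e.
Qed.

Lemma meets_anc x y u : meets x y u -> anc x u = anc y u.
Proof.
by move=> [xu yu e]; apply: pointP => [|k]; rewrite /= !max_r.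
Qed.

Lemma anc_meets x y u : ht x <= u -> ht y <= u -> anc x u = anc y u -> meets x y u.
Proof.
move=> xu yu e; split=> // k.
by rewrite -(lab_anc xu) -(lab_anc yu) e.
Qed.

(** At height 2 ^ m, for large m, both lines have left all levels up to m, and
    the labels of the higher levels are the base labels. *)
Lemma meets_ex x y : proper_point x -> proper_point y -> exists u, meets x y u.
Proof.
move=> [x0 _ [N xN]] [y0 _ [M yM]].
pose m := maxn (maxn N M) (Num.bound (Num.max (ht x) (ht y))).
have hm : Num.max (ht x) (ht y) < 2 ^+ m.
  have h0 : 0 <= Num.max (ht x) (ht y) by rewrite le_max x0.
  apply: (lt_le_trans (archi_boundP h0)).
  rewrite -natrX ler_nat; apply: (leq_trans (ltnW (ltn_expl _ (ltnSn 1)))).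
  by rewrite leq_exp2l // leq_maxr.
move: hm; rewrite gt_max => /andP[xm ym].
exists (2 ^+ m); split; [exact: ltW|exact: ltW|move=> k].
rewrite /mask; case: (leqP k m) => km.
  have out (t : R) : t < 2 ^+ m -> (blk k (2 ^+ m : R) == blk k t) = false.
    have -> : (2 ^+ m : R) = (2 ^+ (m - k) : int)%:~R * 2 ^+ k.
      by have := @dyadicM R k m 1 km; rewrite !mul1r.
    by move=> tm; apply: gt_eqF; rewrite blk_mul blk_lt.
  by rewrite !out.
have in_ (t : R) : 0 <= t -> t <= 2 ^+ m -> blk k t = 0.
  move=> t0 tm; apply/blkP; rewrite mul0r t0 add0r mul1r (le_lt_trans tm) //.
  by rewrite ltr_eXn2l // ltr1n.
by rewrite !in_ // ?ltW // xN ?yM //; move: km; rewrite /m; lia.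
Qed.

Lemma meet_ht_le x y u : meets x y u -> meet_ht x y <= u.
Proof.
by move=> h; apply: ge_inf => //; exists (ht x) => v [].
Qed.

(** The infimum is attained because labels change at integer heights only. *)
Lemma meets_meet_ht x y : proper_point x -> proper_point y -> meets x y (meet_ht x y).
Proof.
move=> px py; set m := meet_ht x y.
have hi : has_inf [set u | meets x y u].
  by split; [exact: meets_ex|exists (ht x) => v []].
have e0 : 0 < (blk 0 m + 1)%:~R - m.
  by rewrite subr_gt0; have /andP[_] := blk_itv 0 m; rewrite expr0 mulr1.
have [u [xu yu e] um] := inf_adherent e0 hi.
have mu : m <= u by exact: meet_ht_le.
have b : blk 0 m = blk 0 u.
  apply/eqP; rewrite eq_le le_blk //= -ltzD1 blk_lt expr0 mulr1.
  by move: um; rewrite -/(meet_ht x y) -/m; lra.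
have xm : ht x <= m by apply: lb_le_inf; [case: hi|move=> v []].
have ym : ht y <= m by apply: lb_le_inf; [case: hi|move=> v []].
split=> // k; have := e k.
by rewrite (mask_mask _ xm mu) (mask_mask _ ym mu) (eq_blk _ b) ?eqxx.
Qed.

Lemma meet_htC x y : meet_ht x y = meet_ht y x.
Proof.
by congr inf; apply/seteqP; split=> u /meets_sym.
Qed.

Lemma meet_ht_anc x u : proper_point x -> ht x <= u -> meet_ht x (anc x u) = u.
Proof.
move=> px xu; apply/eqP; rewrite eq_le; apply/andP; split.
  apply: meet_ht_le; apply: anc_meets => //; first by rewrite ht_anc.
  by rewrite anc_anc.
by have [_] := meets_meet_ht px (proper_anc u px); rewrite ht_anc.
Qed.

Lemma le_meet_ht x y : proper_point x -> proper_point y ->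
  ht x <= meet_ht x y /\ ht y <= meet_ht x y.
Proof. by move=> px py; have [] := meets_meet_ht px py. Qed.

(** Once two lines have merged, they stay together. *)
Lemma meet_ht_ultra x y z : proper_point x -> proper_point y -> proper_point z ->
  meet_ht x z <= Num.max (meet_ht x y) (meet_ht y z).
Proof.
move=> px py pz; apply: meet_ht_le; set m := Num.max _ _.
have [xm ym exy] : meets x y m.
  by apply: meets_up (meets_meet_ht px py) _; rewrite le_max lexx.
have [_ zm eyz] : meets y z m.
  by apply: meets_up (meets_meet_ht py pz) _; rewrite le_max lexx orbT.
by split=> // k; rewrite exy.
Qed.

Lemma tdistxx x : proper_point x -> tdist x x = 0.
Proof.
move=> px; rewrite /tdist.
have -> : meet_ht x x = ht x; last by lra.
apply/eqP; rewrite eq_le (le_meet_ht px px).1 andbT.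
by apply: meet_ht_le.
Qed.

Lemma tdist0 x y : proper_point x -> proper_point y -> tdist x y = 0 -> x = y.
Proof.
move=> px py; rewrite /tdist => d0.
have [xm ym e] := meets_meet_ht px py.
have hx : meet_ht x y = ht x by lra.
have hy : meet_ht x y = ht y by lra.
apply: pointP => [|k]; first by rewrite -hx.
by have := e k; rewrite {1}hx hy !mask_ht.
Qed.

Lemma tdistC x y : tdist x y = tdist y x.
Proof. by rewrite /tdist meet_htC; ring. Qed.

Lemma tdist_triangle y x z : proper_point x -> proper_point y -> proper_point z ->
  tdist x z <= tdist x y + tdist y z.
Proof.
move=> px py pz; rewrite /tdist.
have [_ h1] := le_meet_ht px py; have [h2 _] := le_meet_ht py pz.
have := meet_ht_ultra px py pz; rewrite le_max => /orP[]; lra.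
Qed.

(** Trees are 0-hyperbolic: for an ultrametric, the two largest of the three
   sums of opposite sides of a quadrangle coincide. *)
Lemma tdist_four x y z w : proper_point x -> proper_point y ->
    proper_point z -> proper_point w ->
  tdist x y + tdist z w <= Num.max (tdist x z + tdist y w) (tdist x w + tdist y z).
Proof.
move=> px py pz pw; rewrite /tdist.
have := meet_ht_ultra px pz py; have := meet_ht_ultra px pw py.
have := meet_ht_ultra pz px pw; have := meet_ht_ultra pz py pw.
rewrite (meet_htC w y) (meet_htC z y) (meet_htC z x) !le_max.
have [|] := leP (meet_ht x y) (meet_ht z w).
  by move=> ?; do 4![case/orP => ?]; apply/orP; first [left; lra|right; lra].
by move=> ?; do 4![case/orP => ?]; apply/orP; first [left; lra|right; lra].
Qed.

Lemma tdist_anc x u v : proper_point x -> ht x <= u -> ht x <= v ->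
  tdist (anc x u) (anc x v) = `|u - v|.
Proof.
move=> px; wlog uv : u v / u <= v => [hw|] xu xv.
  have [/hw->//|/ltW vu] := leP u v.
  by rewrite tdistC hw // distrC.
rewrite -(anc_anc x uv) /tdist meet_ht_anc ?ht_anc //; last exact: proper_anc.
by rewrite ler0_norm ?subr_le0 //; lra.
Qed.

Lemma tdist_anc1 x u : proper_point x -> ht x <= u -> tdist x (anc x u) = u - ht x.
Proof.
move=> px xu; rewrite -{1}(anc_le (lexx (ht x))) tdist_anc // ler0_norm ?subr_le0 //.
by lra.
Qed.

Lemma tdist_ge_ht x y : proper_point x -> proper_point y -> `|ht x - ht y| <= tdist x y.
Proof.
move=> px py; have [h1 h2] := le_meet_ht px py; rewrite /tdist.
by rewrite ler_norml; apply/andP; split; lra.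
Qed.

(** The ascending lines merge at the same height as before, unless one of the new
    points is already above the merging point. *)
Lemma tdist_anc_le x y u v : proper_point x -> proper_point y ->
    ht x <= u -> ht y <= v ->
  tdist (anc x u) (anc y v) <= Num.max (tdist x y) `|u - v|.
Proof.
move=> px py xu yv.
have [h1 h2] := le_meet_ht px py.
set m := meet_ht x y in h1 h2.
have mm : meets (anc x u) (anc y v) (Num.max m (Num.max u v)).
  have um : u <= Num.max m (Num.max u v) by rewrite !le_max lexx orbT.
  have vm : v <= Num.max m (Num.max u v) by rewrite !le_max lexx !orbT.
  apply: anc_meets; rewrite ?ht_anc // !anc_anc //.
  apply: meets_anc; apply: meets_up (meets_meet_ht px py) _.
  by rewrite le_max lexx.
have := ler_norm (u - v); have := ler_norm (v - u); rewrite (distrC v u) => n1 n2.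
have := meet_ht_le mm; rewrite le_max /tdist -/m !ht_anc // !le_max.
by case/orP => [|/orP[]] ?; apply/orP; first [left; lra|right; lra].
Qed.

Lemma meet_ht_anc2 x y u v : proper_point x -> proper_point y ->
    ht x <= u <= meet_ht x y -> ht y <= v <= meet_ht x y ->
  meet_ht (anc x u) (anc y v) = meet_ht x y.
Proof.
move=> px py /andP[xu um] /andP[yv vm]; apply/eqP; rewrite eq_le; apply/andP; split.
  apply: meet_ht_le; apply: anc_meets; rewrite ?ht_anc // !anc_anc //.
  exact: meets_anc (meets_meet_ht px py).
have hm := meets_meet_ht (proper_anc u px) (proper_anc v py).
apply: meet_ht_le; have [um' vm' _] := hm; rewrite ht_anc // in um'; rewrite ht_anc // in vm'.
apply: anc_meets; [exact: le_trans um'|exact: le_trans vm'|].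
by rewrite -(anc_anc x um') -(anc_anc y vm'); exact: meets_anc.
Qed.

(** The point at height s on the branch of level j and label c that hangs from x. *)
Definition hang x j c s := LPoint s (fun k => if k == j then Some c else lab x k).

Lemma lab_hang x j c s k : lab (hang x j c s) k = if k == j then Some c else lab x k.
Proof. by []. Qed.

Section Hang.
Variables (x : lpoint) (j : nat) (c : L) (m : int) (s : R).
Hypotheses (px : proper_point x) (x0 : forall k, (k <= j)%N -> lab x k = None).
Hypothesis hx : ht x = (m * 2 + 1)%:~R * 2 ^+ j.
Hypothesis hs : ht x - 2 ^+ j <= s < ht x.

Lemma blk_hang_top : blk j.+1 (ht x) = m.
Proof.
rewrite hx; apply/blkP; rewrite exprS !intrD !intrM; have := exp2_gt0 (R := R) j.
by move=> ?; apply/andP; split; lra.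
Qed.

Lemma blk_hang : blk j s = m * 2 /\ blk j.+1 s = m.
Proof. by apply: blk_odd; rewrite -hx. Qed.

Lemma proper_hang : proper_point (hang x j c s).
Proof.
have [bj bj1] := blk_hang; have [xge0 xd [N xN]] := px; split => /=.
- have m0 : 0 <= m.
    by rewrite -blk_hang_top; exact: blk_ge0.
  by have := blk_itv j s; rewrite bj => /andP[+ _]; apply: le_trans; rewrite mulr_ge0 // ler0z; lia.
- move=> k; case: eqP => [-> _|/eqP kj]; first by rewrite /digit0 bj bj1.
  have [/x0->//|jk] := leqP k j.
  by move/xd; apply: (@eq_digit0 _ j.+1); rewrite // bj1 blk_hang_top.
- exists (maxn N j.+1) => k; rewrite geq_max => /andP[Nk jk].
  by rewrite gtn_eqF // xN.
Qed.

Lemma anc_hang_top : anc (hang x j c s) (ht x) = x.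
Proof.
have [bj bj1] := blk_hang; have /andP[_ /ltW sx] := hs.
apply: pointP => [|k]; first by rewrite ht_anc.
rewrite lab_anc //= /mask /=; have [kj|jk|->] := ltngtP k j.
- by rewrite x0 1?ltnW //; case: ifP.
- by rewrite (@eq_blk _ j.+1 k (ht x) s jk) ?eqxx // blk_hang_top bj1.
- have -> : blk j (ht x) = m * 2 + 1 by rewrite hx blk_mul.
  by rewrite bj x0 // (_ : _ == _ = false) //; lia.
Qed.

End Hang.

(** The bottom of the branch of level i on which all later labels are the base
    labels. *)
Definition root_point i := LPoint 0 (fun k => if (k < i)%N then None else Some (base k)).

Lemma blk_zero k : blk k (0 : R) = 0.
Proof. by apply/blkP; rewrite mul0r lexx /= mul1r. Qed.

Lemma proper_root i : proper_point (root_point i).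
Proof.
split=> //=; first by move=> k _; rewrite /digit0 !blk_zero.
by exists i => k; rewrite leqNgt => /negbTE ->.
Qed.

End RawTree.
Arguments lpoint R L : clear implicits.

(** * Geodesics in 0-hyperbolic spaces *)

Section FourPoint.
Context {R : realType} {T : metricType R}.
Implicit Types (A S : set T) (x y z w : T).

Definition four_point := forall x y z w,
  mdist x y + mdist z w <=
  Num.max (mdist x z + mdist y w) (mdist x w + mdist y z).

Hypothesis four : four_point.

(** The four point condition for x, y, z, w bounds mdist z w by 0. *)
Lemma four_point_between x y z w :
  mdist x z + mdist z y = mdist x y -> mdist x w + mdist w y = mdist x y ->
  mdist x z = mdist x w -> z = w.
Proof.
move=> ez ew e; apply: mdist_positivity; apply/eqP; rewrite eq_le mdist_ge0 andbT.
have := four x y z w.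
rewrite (metric_sym y w) (metric_sym y z) le_max => /orP[]; lra.
Qed.

Lemma geodesic_segmentE A x y S : geodesic_segment A x y S ->
  S = [set z | mdist x z + mdist z y = mdist x y].
Proof.
move=> [g [g0 g1 gi -> _]].
have din : mdist x y \in `[0, mdist x y] by rewrite in_itv /= mdist_ge0 lexx.
have oin : 0 \in `[0, mdist x y] by rewrite in_itv /= mdist_ge0 lexx.
have gd s : s \in `[0, mdist x y] -> mdist x (g s) = s /\ mdist (g s) y = mdist x y - s.
  move=> sin; move: (sin); rewrite in_itv /= => /andP[s0 sd].
  split; first by rewrite -{1}g0 gi // sub0r normrN ger0_norm.
  by rewrite -{1}g1 gi // ler0_norm ?subr_le0 // opprB.
apply/seteqP; split=> [_ [s /= sin <-]|z /= ez].
  by have [-> ->] := gd _ sin; ring.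
have zin : mdist x z \in `[0, mdist x y].
  by rewrite in_itv /= mdist_ge0 -ez lerDl mdist_ge0.
exists (mdist x z) => //; have [e1 e2] := gd _ zin.
by apply: (@four_point_between x y) => //; rewrite e1 e2; ring.
Qed.

Lemma geodesic_sub A x y S : geodesic_segment A x y S -> S `<=` A.
Proof. by case=> g []. Qed.

Lemma geodesic_itv A x y S r : geodesic_segment A x y S -> 0 <= r <= mdist x y ->
  exists2 z, S z & mdist x z = r /\ mdist z y = mdist x y - r.
Proof.
move=> h rin; case: h => g [g0 g1 gi -> _].
have rin' : r \in `[0, mdist x y] by rewrite in_itv.
exists (g r); first by exists r.
case/andP: rin => r0 rd; split.
  by rewrite -{1}g0 gi // ?sub0r ?normrN ?ger0_norm // in_itv /= lexx mdist_ge0.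
by rewrite -{1}g1 gi // ?ler0_norm ?subr_le0 ?opprB // in_itv /= lexx mdist_ge0.
Qed.

(** If two segments share only an endpoint y, the Gromov product of the other
    ends at y vanishes: by the four point condition the two segments agree up to
    that distance from y.  Hence lengths add up and the union is geodesic. *)
Lemma four_point_rtree A :
  (forall x y, A x -> A y -> exists S, geodesic_segment A x y S) -> rtree A.
Proof.
move=> ex; split=> [x y Ax Ay|x y z S1 S2 h1 h2 S12].
  have [S hS] := ex x y Ax Ay; exists S; split=> // S' hS'.
  by rewrite (geodesic_segmentE hS) (geodesic_segmentE hS').
pose r := (mdist x y + mdist y z - mdist x z) / 2.
have t1 := metric_triangle x y z.
have t2 := metric_triangle x z y; have t3 := metric_triangle y x z.
rewrite (metric_sym z y) in t2; rewrite (metric_sym y x) in t3.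
have r1 : 0 <= mdist x y - r <= mdist x y by rewrite /r; apply/andP; split; lra.
have r2 : 0 <= r <= mdist y z by rewrite /r; apply/andP; split; lra.
have [p Sp [xp py]] := geodesic_itv h1 r1.
have [q Sq [yq qz]] := geodesic_itv h2 r2.
have pz : mdist z p <= mdist y z - r.
  have := four x y z p; rewrite (metric_sym y p) le_max.
  by move: xp py; rewrite /r => xp py /orP[]; lra.
have pq : p = q.
  apply: (@four_point_between y z) => //.
  - have := metric_triangle y p z; rewrite (metric_sym y p) (metric_sym p z); lra.
  - by rewrite yq qz; ring.
  - by rewrite (metric_sym y p) yq py; ring.
have {}py : p = y by have : (S1 `&` S2) p by [split=> //; rewrite pq]; rewrite S12.
have r0 : r = 0 by rewrite -yq -pq py mdistxx.
have dxz : mdist x z = mdist x y + mdist y z by move: r0; rewrite /r; lra.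
have [g1 [g10 g11 g1i eS1 sS1]] := h1; have [g2 [g20 g21 g2i eS2 sS2]] := h2.
have xy0 := mdist_ge0 x y; have yz0 := mdist_ge0 y z.
pose g s := if s <= mdist x y then g1 s else g2 (s - mdist x y).
have gle s : s <= mdist x y -> g s = g1 s by rewrite /g => ->.
have gge s : mdist x y <= s -> g s = g2 (s - mdist x y).
  move=> s2; rewrite /g; case: (leP s) => // s1; have -> : s = mdist x y by lra.
  by rewrite g11 subrr g20.
exists g; split.
- by rewrite gle.
- by rewrite gge dxz ?lerDl // addrAC subrr add0r.
- move=> s t; wlog st : s t / s <= t => [hw sin tin|].
    have [/hw->//|/ltW ts] := leP s t.
    by rewrite metric_sym hw // distrC.
  rewrite !in_itv /= dxz => /andP[s0 s1] /andP[u0 u1].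
  have [sx|xs] := leP s (mdist x y); last first.
    have tx : mdist x y <= t by lra.
    rewrite !gge ?(ltW xs) // g2i ?in_itv /=; try by apply/andP; split; lra.
    by congr (`|_|); ring.
  have [tx|xt] := leP t (mdist x y).
    by rewrite !gle // g1i // in_itv /= ?s0 ?u0.
  rewrite (gle s) // (gge t) ?(ltW xt) // ler0_norm ?subr_le0 // opprB.
  have e1 : mdist x (g1 s) = s.
    by rewrite -{1}g10 g1i ?in_itv /= ?lexx ?s0 // sub0r normrN ger0_norm.
  have e2 : mdist (g1 s) y = mdist x y - s.
    by rewrite -{1}g11 g1i ?in_itv /= ?lexx ?s0 ?xy0 // ler0_norm ?subr_le0 // opprB.
  have tin : 0 <= t - mdist x y <= mdist y z by apply/andP; split; lra.
  have e3 : mdist y (g2 (t - mdist x y)) = t - mdist x y.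
    by rewrite -{1}g20 g2i ?in_itv /= ?lexx ?yz0 // sub0r normrN ger0_norm; case/andP: tin.
  have e4 : mdist (g2 (t - mdist x y)) z = mdist y z - (t - mdist x y).
    by rewrite -{1}g21 g2i ?in_itv /= ?lexx ?yz0 // ler0_norm ?subr_le0 ?opprB //; case/andP: tin.
  have t4 := metric_triangle (g1 s) y (g2 (t - mdist x y)).
  have t5 := metric_triangle x (g1 s) z.
  have t6 := metric_triangle (g1 s) (g2 (t - mdist x y)) z.
  by apply/eqP; rewrite eq_le; apply/andP; split; lra.
- rewrite eS1 eS2; apply/seteqP; split=> w [].
  + case=> s /= + <-; rewrite in_itv /= => /andP[s0 s1].
    by exists s; [rewrite /= in_itv /= dxz; apply/andP; split; lra|rewrite gle].
  + case=> s /= + <-; rewrite in_itv /= => /andP[s0 s1].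
    exists (s + mdist x y); first by rewrite /= in_itv /= dxz; apply/andP; split; lra.
    by rewrite gge ?lerDr // addrK.
  + move=> s; rewrite /= in_itv /= dxz => /andP[s0 s1] <-.
    have [sx|xs] := leP s (mdist x y).
      by left; rewrite gle //; exists s; rewrite //= in_itv /= s0.
    right; rewrite gge ?(ltW xs) //; exists (s - mdist x y) => //=.
    by rewrite in_itv /=; apply/andP; split; lra.
- by move=> w [/sS1|/sS2].
Qed.

End FourPoint.

(** * The trees and their strata *)

(** Labels, and a relation that tells which branches may occur together on an
    ascending line: compat k c j c' allows a branch of level k and label c to hang
    below one of level j and label c'.  The last two fields make every vertex branch,
    and every vertex have finitely many children. *)
Record label_system := LabelSystem {
  lbl : Type ;
  base : nat -> lbl ;
  compat : nat -> lbl -> nat -> lbl -> Prop ;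
  compat_base : forall k j c, compat k (base k) j c ;
  compat_finite : forall k j c, finite_set [set c' | compat k c' j c] }.

Section Tree.
Context {R : realType} (D : label_system).

Definition compatible (x : lpoint R (lbl D)) := forall k j c c', (k < j)%N ->
  lab x k = Some c -> lab x j = Some c' -> @compat D k c j c'.

Record tree := Tree {
  tval :> lpoint R (lbl D) ;
  tree_proper : proper_point (@base D) tval ;
  tree_compatible : compatible tval }.

HB.instance Definition _ := gen_eqMixin tree.
HB.instance Definition _ := gen_choiceMixin tree.

Lemma tree_inj (x y : tree) : tval x = tval y -> x = y.
Proof.
case: x y => [x p q] [y p' q'] /= e; case: _ / e p' q' => p' q'.
by rewrite (Prop_irrelevance p p') (Prop_irrelevance q q').
Qed.

HB.instance Definition _ := @isMetric.Build R tree (fun x y => tdist x y)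
  (fun x => tdistxx (tree_proper x))
  (fun x y e => tree_inj (tdist0 (tree_proper x) (tree_proper y) e))
  (fun x y => tdistC x y)
  (fun y x z => tdist_triangle (tree_proper x) (tree_proper y) (tree_proper z)).

Implicit Types (x y z w p : tree) (u v s : R) (i j k : nat).

Lemma treeP x y : ht x = ht y -> lab x =1 lab y -> x = y.
Proof. by move=> h l; apply/tree_inj/pointP. Qed.

Lemma mdistE x y : mdist x y = tdist x y.
Proof. by []. Qed.

Lemma compatible_anc x u : compatible (anc x u).
Proof.
move=> k j c c' kj /=; rewrite /mask; do 2![case: eqP => // _].
exact: tree_compatible.
Qed.

Definition up x u := Tree (proper_anc u (tree_proper x)) (@compatible_anc x u).

Lemma ht_up x u : ht x <= u -> ht (up x u) = u.
Proof. exact: ht_anc. Qed.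

Lemma lab_up x u : ht x <= u -> lab (up x u) = mask x u.
Proof. exact: lab_anc. Qed.

Lemma up_up x u v : u <= v -> up (up x u) v = up x v.
Proof. by move=> uv; apply: tree_inj; exact: anc_anc. Qed.

Lemma up_le x u : u <= ht x -> up x u = x.
Proof. by move=> ux; apply: tree_inj; exact: anc_le. Qed.

Lemma mdist_up x u v : ht x <= u -> ht x <= v -> mdist (up x u) (up x v) = `|u - v|.
Proof. exact: tdist_anc (tree_proper x). Qed.

Lemma mdist_up1 x u : ht x <= u -> mdist x (up x u) = u - ht x.
Proof. exact: tdist_anc1 (tree_proper x). Qed.

Lemma mdist_ht x y : `|ht x - ht y| <= mdist x y.
Proof. exact: tdist_ge_ht (tree_proper x) (tree_proper y). Qed.

Lemma meet_hts x y : ht x <= meet_ht x y /\ ht y <= meet_ht x y.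
Proof. exact: le_meet_ht (tree_proper x) (tree_proper y). Qed.

Lemma meets_mu x y : meets x y (meet_ht x y).
Proof. exact: meets_meet_ht (tree_proper x) (tree_proper y). Qed.

Lemma up_meets x y u : meets x y u -> up x u = up y u.
Proof. by move=> h; apply/tree_inj/meets_anc. Qed.

Lemma meets_up_eq x y u : ht x <= u -> ht y <= u -> up x u = up y u -> meets x y u.
Proof. by move=> xu yu e; apply: anc_meets => //; have := congr1 tval e. Qed.

Lemma tree_four_point : @four_point R tree.
Proof.
by move=> x y z w; apply: tdist_four (tree_proper x) (tree_proper y) (tree_proper z) (tree_proper w).
Qed.

(** The points that belong to no branch of level less than k.  These sets are the
    filtration. *)
Definition stratum k : set tree := [set x | forall l, (l < k)%N -> lab x l = None].

Lemma stratum_up k x u : stratum k x -> stratum k (up x u).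
Proof. by move=> xk l lk /=; rewrite /mask xk //; case: ifP. Qed.

Lemma stratum_geodesic k x y : stratum k x -> stratum k y ->
  exists S, geodesic_segment (stratum k) x y S.
Proof.
move=> xk yk; set d := mdist x y; set m := meet_ht x y.
have [xm ym] := meet_hts x y; rewrite -/m in xm ym.
have dE : d = m * 2 - ht x - ht y by [].
(* up from x to the merging point, then down to y *)
pose g s := if s <= m - ht x then up x (ht x + s) else up y (ht y + (d - s)).
exists (g @` `[0, d]); exists g; split=> //.
- by rewrite /g subr_ge0 xm addr0 up_le.
- rewrite /g -/d; case: ifP => dm; last by rewrite subrr addr0 up_le.
  have -> : ht x + d = m by move: dm ym; rewrite dE; lra.
  rewrite (up_meets (meets_mu x y)) up_le //; move: dm ym; rewrite dE -/m; lra.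
- move=> s t; wlog st : s t / s <= t => [hw sin tin|].
    have [/hw->//|/ltW ts] := leP s t.
    by rewrite metric_sym hw // distrC.
  rewrite !in_itv /= -/d => /andP[s0 s1] /andP[t0 t1]; rewrite /g.
  have [tm|mt] := leP t (m - ht x); have [sm|ms] := leP s (m - ht x).
  + by rewrite mdist_up ?lerDl //; congr (`|_|); ring.
  + exfalso; lra.
  + have u1 : ht x <= ht x + s <= meet_ht x y by rewrite -/m; apply/andP; split; lra.
    have u2 : ht y <= ht y + (d - t) <= meet_ht x y by rewrite -/m; apply/andP; split; lra.
    rewrite mdistE /tdist (meet_ht_anc2 (tree_proper x) (tree_proper y) u1 u2) -/m.
    by rewrite !ht_up ?ler0_norm; rewrite ?dE; lra.
  + rewrite mdist_up; [|lra|lra].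
    by rewrite distrC; congr (`|_|); ring.
- by move=> _ [s _ <-]; rewrite /g; case: ifP => _; exact: stratum_up.
Qed.

Lemma stratum_rtree k : rtree (stratum k).
Proof. by apply: four_point_rtree tree_four_point _ _ => x y; exact: stratum_geodesic. Qed.

Lemma stratum0 : stratum 0 = setT.
Proof. by apply/seteqP; split. Qed.

Lemma stratumW i j : (i <= j)%N -> stratum j `<=` stratum i.
Proof. by move=> ij x xj l li; apply: xj; exact: leq_trans ij. Qed.

Lemma label_ex x i : exists k, (i <= k)%N /\ lab x k = Some (@base D k).
Proof.
have [_ _ [N xN]] := tree_proper x; exists (maxn i N).
by rewrite leq_maxl xN ?leq_maxr.
Qed.

Lemma stratum_bigcap : \bigcap_i stratum i = set0.
Proof.
apply/seteqP; split=> // x xi; have [k [_ xk]] := label_ex x 0.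
by have := xi k.+1 I k (ltnSn k); rewrite xk.
Qed.

(** In the i-th stratum, labels are constant along the blocks of length 2 ^ i. *)
Lemma slide_ex i x s : stratum i x -> blk i s = blk i (ht x) ->
  exists y : tree, ht y = s /\ lab y = lab x.
Proof.
move=> xi e; have [x0 xd xN] := tree_proper x.
have pp : proper_point (@base D) (LPoint s (lab x)).
  split=> //=.
    have : 0 <= blk i s by rewrite e blk_ge0.
    by rewrite blk_ge mul0r.
  move=> k xk; have [ki|ik] := ltnP k i; first by rewrite xi in xk.
  by apply: eq_digit0 ik e _; exact: xd.
by have cc : compatible (LPoint s (lab x)); [exact: tree_compatible|exists (Tree pp cc)].
Qed.

Lemma hang_ex x j c m s : (forall k, (k <= j)%N -> lab x k = None) ->
  ht x = (m * 2 + 1)%:~R * 2 ^+ j -> ht x - 2 ^+ j <= s < ht x ->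
  (forall k c', (j < k)%N -> lab x k = Some c' -> @compat D j c k c') ->
  exists y : tree, tval y = hang x j c s.
Proof.
move=> x0 hx hs cc.
have pp : proper_point (@base D) (hang x j c s) := proper_hang c (tree_proper x) x0 hx hs.
have cp : compatible (hang x j c s).
  move=> k l c1 c2 + /=; case: (k =P j) => [-> jl [<-]|/eqP kj kl].
    by rewrite gtn_eqF //; exact: cc.
  case: (l =P j) => [lj|_]; last exact: tree_compatible.
  by rewrite x0 //; lia.
by exists (Tree pp cp).
Qed.

End Tree.

(** * Segments in metric spaces *)

Section Segments.
Context {R : realType} {T : metricType R}.
Hypothesis four : @four_point R T.
Implicit Types (A S I : set T) (x y z w v : T).

Lemma geodesic_dist A x y I z w : geodesic_segment A x y I -> I z -> I w ->
  mdist z w = `|mdist x z - mdist x w|.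
Proof.
move=> [g [g0 g1 gi -> _]] [s sin <-] [t tin <-].
have oin : 0 \in `[0, mdist x y] by rewrite in_itv /= mdist_ge0 lexx.
move: (sin) (tin); rewrite /= !in_itv /= => /andP[s0 _] /andP[t0 _].
by rewrite gi // -{1 2}g0 !gi // !sub0r !normrN (ger0_norm s0) (ger0_norm t0).
Qed.

(** If a removed endpoint lies between two points of the segment, it is one of
    them; this is why open and half-open segments are convex too. *)
Lemma geodesic_convex A x y I z w v : geodesic_segment A x y I -> I z -> I w ->
    mdist x z <= mdist x w -> mdist z v + mdist v w = mdist z w ->
  [/\ I v, v = x -> z = x & v = y -> w = y].
Proof.
move=> h Iz Iw zw zvw; have dzw := geodesic_dist h Iz Iw.
rewrite ler0_norm ?subr_le0 // in dzw.
have E := geodesic_segmentE four h.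
have ez : mdist x z + mdist z y = mdist x y by move: Iz; rewrite E.
have ew : mdist x w + mdist w y = mdist x y by move: Iw; rewrite E.
have t1 := metric_triangle x z v; have t2 := metric_triangle v w y.
have t3 := metric_triangle x v y.
have t4 := mdist_ge0 v w; have t5 := mdist_ge0 z v.
have t6 := mdist_ge0 w y; have t7 := mdist_ge0 x z.
split; first by rewrite E /=; lra.
  move=> vx; apply: mdist_positivity; rewrite (metric_sym z x).
  by have := mdistxx x; rewrite -{2}vx => ?; lra.
move=> vy; apply: mdist_positivity.
by have := mdistxx y; rewrite -{1}vy => ?; lra.
Qed.

Lemma free_segment_geodesic A S : free_segment A S ->
  exists x y I, [/\ x <> y, geodesic_segment A x y I, S `<=` I
    & forall v, I v -> v <> x -> v <> y -> S v].
Proof.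
case=> -[] [x [y [I [xy hI ->]]]] _; exists x, y, I; split=> //.
by move=> v Iv vx vy; split=> // -[].
Qed.

Lemma free_segment_nonempty A S : free_segment A S -> exists z, S z.
Proof.
move=> /free_segment_geodesic[x [y [I [xy hI SI IS]]]].
have d0 : 0 < mdist x y by rewrite mdist_gt0; apply/eqP.
have rin : 0 <= mdist x y / 2 <= mdist x y by apply/andP; split; lra.
have [z Iz [xz zy]] := geodesic_itv hI rin; exists z; apply: IS => //.
  by move=> zx; have := mdistxx x; rewrite -{2}zx; lra.
by move=> zx; have := mdistxx y; rewrite -{1}zx; lra.
Qed.

Lemma free_segment_sub A S : free_segment A S -> S `<=` A.
Proof.
by move=> /free_segment_geodesic[x [y [I [_ hI SI _]]]] z /SI; apply: geodesic_sub hI z.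
Qed.

Lemma free_segment_convex A S z w v : free_segment A S -> S z -> S w ->
  mdist z v + mdist v w = mdist z w -> S v.
Proof.
move=> hS Sz Sw zvw.
have [x [y [I [xy hI SI IS]]]] := free_segment_geodesic hS.
wlog zw : z w Sz Sw zvw / mdist x z <= mdist x w => [hw|].
  have [|/ltW] := leP (mdist x z) (mdist x w); first exact: hw.
  by apply: hw => //; rewrite (metric_sym w v) (metric_sym v z) (metric_sym w z) addrC.
have [Iv vx vy] := geodesic_convex hI (SI _ Sz) (SI _ Sw) zw zvw.
have [vx'|nvx] := pselect (v = x); first by rewrite vx' -(vx vx').
have [vy'|nvy] := pselect (v = y); first by rewrite vy' -(vy vy').
exact: IS.
Qed.

(** A segment has only two directions at each of its points. *)
Lemma free_segment_triple A S p a b c (e : R) : free_segment A S ->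
    S p -> S a -> S b -> S c -> 0 < e ->
    mdist p a = e -> mdist p b = e -> mdist p c = e ->
  a <> b -> a <> c -> b <> c -> False.
Proof.
move=> /free_segment_geodesic[x [y [I [_ hI SI _]]]].
move=> /SI Ip /SI Ia /SI Ib /SI Ic e0.
rewrite (geodesic_dist hI Ip Ia) (geodesic_dist hI Ip Ib) (geodesic_dist hI Ip Ic).
have inj z w : I z -> I w -> mdist x z = mdist x w -> z = w.
  by move=> Iz Iw e1; apply: mdist_positivity; rewrite (geodesic_dist hI Iz Iw) e1 subrr normr0.
move=> da db dc ab ac bc.
have nab : mdist x a != mdist x b by apply/eqP => /(inj _ _ Ia Ib).
have nac : mdist x a != mdist x c by apply/eqP => /(inj _ _ Ia Ic).
have nbc : mdist x b != mdist x c by apply/eqP => /(inj _ _ Ib Ic).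
have two z : `|mdist x p - mdist x z| = e ->
    mdist x z = mdist x p - e \/ mdist x z = mdist x p + e.
  by case: (ler0P (mdist x p - mdist x z)) => _ ?; [right|left]; lra.
move/eqP: nab; move/eqP: nac; move/eqP: nbc.
by case: (two _ da) => ->; case: (two _ db) => ->; case: (two _ dc) => ->.
Qed.

Lemma open_in_locally A S : S `<=` A ->
  (forall w, S w -> exists2 e, 0 < e & forall v, A v -> mdist w v < e -> S v) ->
  open_in A S.
Proof.
move=> SA loc.
pose U := \bigcup_(we in [set we : T * R | 0 < we.2 /\
   forall v, A v -> mdist we.1 v < we.2 -> S v]) ball we.1 we.2.
exists U.
  apply: bigcup_open => -[w e] /= [e0 _]; rewrite openE => v.
  rewrite ballEmdist /= => wv; apply/nbhs_ballP; exists (e - mdist w v) => /=.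
    by rewrite subr_gt0.
  move=> u; rewrite !ballEmdist /= => vu.
  have := metric_triangle w v u; lra.
apply/seteqP; split=> v.
  move=> Sv; split; last exact: SA.
  by have [e e0 he] := loc v Sv; exists (v, e); [split|exact: ballxx].
by move=> [[[w e] /= [e0 he]]]; rewrite ballEmdist /= => wv Av; exact: he.
Qed.

End Segments.

(** * Edges and nodes of the strata *)

Section Edges.
Context {R : realType} (D : label_system).
Local Notation T := (@tree R D).
Implicit Types (x y z w p q v : T) (i j k l : nat).

Definition dyadic k (t : R) := t = (blk k t)%:~R * 2 ^+ k.

Lemma dyadicW i j t : (i <= j)%N -> dyadic j t -> dyadic i t.
Proof. by move=> ij; rewrite /dyadic (dyadicM _ ij) => ->; rewrite blk_mul. Qed.

Lemma dyadic_le k t u : dyadic k t -> u < t -> blk k u < blk k t.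
Proof. by move=> d ut; rewrite blk_lt -d. Qed.

(** A node of the i-th stratum is not the lower end of a branch, and its height is
    one at which branches of level i or more can hang. *)
Definition node i p :=
  [/\ @stratum R D i p, dyadic i (ht p) & forall l, lab p l <> None -> ~ dyadic l (ht p)].

Lemma node_odd i p : node i p -> exists j m,
  [/\ (i <= j)%N, ht p = (m * 2 + 1)%:~R * 2 ^+ j & forall k, (k <= j)%N -> lab p k = None].
Proof.
move=> [pi di nd].
have ex : exists l, `[< ~ dyadic l (ht p) >].
  by have [k [_ e]] := label_ex p 0; exists k; apply/asboolP/nd; rewrite e.
case: (ex_minnP ex) => -[|j] /asboolP hj minj.
  by exfalso; apply: hj; exact: dyadicW di.
have dj k : (k <= j)%N -> dyadic k (ht p).
  by move=> kj; apply: contrapT => /asboolP /minj; lia.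
have ij : (i <= j)%N.
  by rewrite leqNgt; apply/negP => ji; apply: hj; exact: dyadicW di.
exists j, (blk j.+1 (ht p)); split=> //.
  have /andP[b1 b2] := blk_div2 j (ht p).
  have [e|e] : blk j (ht p) = blk j.+1 (ht p) * 2 \/
      blk j (ht p) = blk j.+1 (ht p) * 2 + 1 by lia.
    exfalso; apply: hj; rewrite /dyadic {1}(dj j) // e exprS intrM; ring.
  by rewrite {1}(dj j) // e.
by move=> k /dj dk; apply: contrapT => /nd.
Qed.

Lemma node_up i z h : @stratum R D i z -> ht z < h -> dyadic i h -> node i (up z h).
Proof.
move=> zi zh dh; have hh : ht (up z h) = h by rewrite ht_up ?ltW.
split; rewrite ?hh //; first exact: stratum_up.
move=> l + dl; rewrite lab_up ?ltW // /mask; case: eqP => // e _.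
by have := dyadic_le dl zh; rewrite e ltxx.
Qed.

(** At a node the stratum has three directions: upwards, downwards along the
    branch through the node, and into a hanging branch with a base label. *)
Lemma node_not_free i p S : free_segment (@stratum R D i) S -> node i p -> ~ S p.
Proof.
move=> hS np Sp; have [pi _ _] := np; have [j [m [ij hp pj]]] := node_odd np.
have [_ [U oU SU]] := hS.
have Up : U p by move: Sp; rewrite SU => -[].
have [e /= e0 he] : exists2 e : R, 0 < e & ball p e `<=` U.
  by apply/nbhs_ballP; exact: open_nbhs_nbhs.
have near_S v : @stratum R D i v -> mdist p v < e -> S v.
  by move=> vi pv; rewrite SU; split=> //; apply: he; rewrite ballEmdist.
pose d := Num.min e (2 ^+ j) / 2.
have [d0 de dj] : [/\ 0 < d, d < e & d < 2 ^+ j].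
  have m0 : 0 < Num.min e (2 ^+ j) by rewrite lt_min e0 exp2_gt0.
  have me : Num.min e (2 ^+ j) <= e by rewrite ge_min lexx.
  have mj : Num.min e (2 ^+ j) <= 2 ^+ j by rewrite ge_min lexx orbT.
  by rewrite /d; split; lra.
have hs : ht p - 2 ^+ j <= ht p - d < ht p by apply/andP; split; lra.
have [_ b1] : blk j (ht p - d) = m * 2 /\ blk j.+1 (ht p - d) = m.
  by apply: blk_odd; rewrite -hp.
have bp : blk j.+1 (ht p) = m := blk_hang_top hp.
have pj1 : @stratum R D j.+1 p by move=> k kj; apply: pj.
have [b [hb lb]] : exists b : T, ht b = ht p - d /\ lab b = lab p.
  by apply: slide_ex pj1 _; rewrite b1 bp.
have [c hc] : exists c : T, tval c = hang p j (@base D j) (ht p - d).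
  by apply: hang_ex hp hs _ => // *; exact: compat_base.
have hcd : ht c = ht p - d by rewrite hc.
have ub : up b (ht p) = p.
  apply: treeP => [|k]; first by rewrite ht_up // hb; lra.
  rewrite lab_up; last by rewrite hb; lra.
  rewrite /mask lb hb; have [kj|jk] := leqP k j; first by rewrite pj //; case: ifP.
  by rewrite (@eq_blk _ j.+1 k (ht p) (ht p - d)) ?eqxx // bp b1.
have uc : up c (ht p) = p.
  by apply: tree_inj; have := anc_hang_top (@base D j) pj hp hs; rewrite -hc.
have bi : @stratum R D i b by move=> k ki; rewrite lb pi.
have ci : @stratum R D i c.
  by move=> k ki; rewrite hc /= ltn_eqF ?pi //; exact: leq_trans ij.
have pa : mdist p (up p (ht p + d)) = d by rewrite mdist_up1; lra.
have pb : mdist p b = d.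
  by rewrite -{1}ub metric_sym mdist_up1 hb; lra.
have pc : mdist p c = d.
  by rewrite -{1}uc metric_sym mdist_up1 hcd; lra.
have ha : ht (up p (ht p + d)) = ht p + d by rewrite ht_up; lra.
apply: (@free_segment_triple _ _ _ _ p (up p (ht p + d)) b c d hS) => //.
- by apply: near_S; rewrite ?pa //; exact: stratum_up.
- by apply: near_S; rewrite ?pb.
- by apply: near_S; rewrite ?pc.
- by move=> ab; move: ha; rewrite ab hb; lra.
- by move=> ac; move: ha; rewrite ac hcd; lra.
- move=> bc; have : lab b j = lab c j by rewrite bc.
  by rewrite lb pj // hc /= eqxx.
Qed.

(** The part of the i-th stratum that lies in the same block of length 2 ^ i as z
    and carries the same labels: a half-open segment of length 2 ^ i, containing
    its lower end. *)
Definition edge i z : set T :=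
  [set w | [/\ @stratum R D i w, blk i (ht w) = blk i (ht z) & lab w = lab z]].

Definition top i z : R := (blk i (ht z) + 1)%:~R * 2 ^+ i.
Definition bottom i z : R := (blk i (ht z))%:~R * 2 ^+ i.

Lemma bottom_top i z : top i z = bottom i z + 2 ^+ i.
Proof. by rewrite /top /bottom intrD; ring. Qed.

Lemma ht_edge i z : bottom i z <= ht z < top i z.
Proof. exact: blk_itv. Qed.

Lemma blk_edge i z (s : R) : bottom i z <= s < top i z -> blk i s = blk i (ht z).
Proof. by move/blkP. Qed.

Lemma edge_of_meet i z w : @stratum R D i z -> @stratum R D i w ->
  meet_ht z w < top i z -> blk i (ht w) = blk i (ht z) -> edge i z w.
Proof.
move=> zi wi mz bw; split=> //; have [zm wm em] := meets_mu z w.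
have bm : blk i (meet_ht z w) = blk i (ht z).
  by apply: blk_edge; rewrite mz (le_trans _ zm) //; case/andP: (ht_edge i z).
apply/funext => k; have [ki|ik] := ltnP k i; first by rewrite zi ?wi.
by have := em k; rewrite !(mask_block ik) // bm.
Qed.

Lemma between_up z w (h : R) : ht z <= h <= meet_ht z w ->
  mdist z (up z h) + mdist (up z h) w = mdist z w.
Proof.
move=> /andP[zh hm]; have [zm wm] := meet_hts z w.
have zhm : ht z <= h <= meet_ht z w by rewrite zh.
have wwm : ht w <= ht w <= meet_ht z w by rewrite lexx.
have e : meet_ht (up z h) w = meet_ht z w.
  have := meet_ht_anc2 (tree_proper z) (tree_proper w) zhm wwm.
  by rewrite (anc_le (lexx (ht w))).
by rewrite mdist_up1 // !mdistE /tdist e ht_up //; ring.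
Qed.

Lemma dyadic_top i z : dyadic i (top i z).
Proof. by rewrite /dyadic /top blk_mul. Qed.

(** Two points of the stratum not on a common edge are separated by a node. *)
Lemma free_sub_edge i z S : free_segment (@stratum R D i) S -> S z -> S `<=` edge i z.
Proof.
move=> hS Sz w Sw.
have zi : @stratum R D i z := free_segment_sub hS Sz.
have wi : @stratum R D i w := free_segment_sub hS Sw.
have low x y : @stratum R D i x -> S x -> S y -> meet_ht x y < top i x.
  move=> xi Sx Sy; rewrite ltNge; apply/negP => tm.
  have /andP[_ xt] := ht_edge i x.
  have xtm : ht x <= top i x <= meet_ht x y by rewrite ltW.
  apply: (node_not_free hS (node_up xi xt (dyadic_top i x))).
  exact: (free_segment_convex (@tree_four_point R D) hS Sx Sy (between_up xtm)).
apply: edge_of_meet => //; first exact: low.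
have [zm wm] := meet_hts z w.
have b x y : ht x <= meet_ht x y -> meet_ht x y < top i x ->
    blk i (meet_ht x y) = blk i (ht x).
  move=> xm mx; apply: blk_edge; rewrite mx (le_trans _ xm) //.
  by case/andP: (ht_edge i x).
by rewrite -(b z w) ?low // meet_htC -(b w z) ?low // meet_htC.
Qed.

(** An edge without its lower end if that end is a node, the full half-open edge
    if it is a tip of the stratum.  These are the maximal free segments. *)
Definition core i z : set T := edge i z `\` node i.

Lemma edge_sym i z w : edge i z w -> edge i w = edge i z.
Proof. by move=> [_ b l]; rewrite /edge b l. Qed.

Lemma edge_refl i z : @stratum R D i z -> edge i z z.
Proof. by []. Qed.

Lemma free_sub_core i z S : free_segment (@stratum R D i) S -> S z -> S `<=` core i z.
Proof.
move=> hS Sz w Sw; split; first exact: free_sub_edge hS Sz w Sw.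
by move=> nw; exact: (node_not_free hS nw).
Qed.

(** Points of the stratum near w lie in the block of w unless they are below w;
    the latter is excluded at a tip, because a branch that occurs at w starts at
    the height of w. *)
Lemma core_open i z : open_in (@stratum R D i) (core i z).
Proof.
apply: open_in_locally => [w [[]]//|w [ew nw]].
have [wi bw lw] := ew; rewrite /core -(edge_sym ew).
have /andP[bhw hwt] := ht_edge i w.
have key v : @stratum R D i v -> mdist w v < top i w - ht w -> bottom i w <= ht v -> edge i w v.
  move=> vi wv hv; have [wm vm] := meet_hts w v.
  have mt : meet_ht w v < top i w by move: wv; rewrite mdistE /tdist; lra.
  apply: edge_of_meet => //; apply: blk_edge; rewrite hv /=.
  exact: le_lt_trans mt.
have [dw|dw] := pselect (dyadic i (ht w)).
  have bE : bottom i w = ht w by rewrite /bottom -dw.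
  have [l [lwl dl]] : exists l, lab w l <> None /\ dyadic l (ht w).
    apply: contrapT => /forallNP H; apply: nw; split=> // l h1 h2.
    by apply: (H l).
  exists (top i w - ht w); first by rewrite subr_gt0.
  move=> v vi wv.
  have hv : ht w <= ht v.
    rewrite leNgt; apply/negP => vw; have [wm vm em] := meets_mu w v.
    have mt : meet_ht w v < top i w by move: wv; rewrite mdistE /tdist; lra.
    have il : (i <= l)%N by rewrite leqNgt; apply/negP => /wi.
    have bm : blk i (meet_ht w v) = blk i (ht w).
      by apply: blk_edge; rewrite mt (le_trans bhw).
    have := em l; rewrite (mask_block il bm) /mask.
    case: eqP => // bl _; have := dyadic_le dl vw; have := le_blk l wm.
    by rewrite bl; lia.
  have ev := key v vi wv (le_trans bhw hv); split=> // nv.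
  have [_ dv _] := nv; have [_ bv lv] := ev.
  have vw : v = w by apply: treeP; rewrite ?lv // dv bv -/(bottom i w) bE.
  by rewrite vw in nv.
have bw' : bottom i w < ht w.
  by rewrite lt_neqAle bhw andbT; apply/eqP => e; apply: dw; rewrite /dyadic -/(bottom i w).
exists (Num.min (top i w - ht w) (ht w - bottom i w)).
  by rewrite lt_min !subr_gt0 hwt.
move=> v vi; rewrite lt_min => /andP[wv1 wv2].
have hv : bottom i w < ht v.
  by have := mdist_ht w v; have := ler_norm (ht w - ht v); lra.
have ev := key v vi wv1 (ltW hv); split=> // -[_ dv _].
by have [_ bv _] := ev; move: hv; rewrite dv bv ltxx.
Qed.

Lemma edge_bottom i z : @stratum R D i z -> exists q,
  [/\ edge i z q, ht q = bottom i z & forall w, edge i z w -> w = up q (ht w)].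
Proof.
move=> zi.
have bb : blk i (bottom i z) = blk i (ht z) by rewrite blk_mul.
have [q [hq lq]] : exists q : T, ht q = bottom i z /\ lab q = lab z.
  exact: slide_ex zi bb.
exists q; split=> //; first by split; rewrite ?hq // => k ki; rewrite lq zi.
move=> w [wi bw lw]; have qw : ht q <= ht w.
  by rewrite hq /bottom -bw; case/andP: (blk_itv i (ht w)).
apply: treeP => [|k]; rewrite ?ht_up ?lab_up // lw.
have [ki|ik] := ltnP k i; first by rewrite /mask lq zi //; case: ifP.
by rewrite (mask_block ik) ?lq // bw hq bb.
Qed.

Lemma edge_segment i z q : @stratum R D i z -> edge i z q -> ht q = bottom i z ->
    (forall w, edge i z w -> w = up q (ht w)) ->
  geodesic_segment (@stratum R D i) q (up q (top i z)) (up q (top i z) |` edge i z).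
Proof.
move=> zi eq hq hw; have [qi bq lq] := eq.
have qt : ht q <= top i z by rewrite hq bottom_top lerDl ltW // exp2_gt0.
have dE : mdist q (up q (top i z)) = 2 ^+ i.
  by rewrite mdist_up1 // hq bottom_top; ring.
exists (fun s => up q (ht q + s)); rewrite dE; split.
- by rewrite addr0 up_le.
- by rewrite hq -bottom_top.
- move=> s t; rewrite !in_itv /= => /andP[s0 _] /andP[t0 _].
  by rewrite mdist_up ?lerDl //; congr (`|_|); ring.
- apply/seteqP; split.
    move=> w [->|ew].
      exists (2 ^+ i); last by rewrite hq -bottom_top.
      by rewrite /= in_itv /= lexx andbT ltW // exp2_gt0.
    exists (ht w - ht q); last by rewrite addrC subrK -hw.
    have [_ bw _] := ew; have := blk_itv i (ht w); rewrite bw -/(bottom i z) -/(top i z).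
    by rewrite bottom_top /= in_itv /= hq => /andP[? ?]; apply/andP; split; lra.
  move=> _ [s /= + <-]; rewrite in_itv /= => /andP[s0 si].
  have [->|ne] := eqVneq s (2 ^+ i); first by left; rewrite hq -bottom_top.
  have hs : ht (up q (ht q + s)) = ht q + s by rewrite ht_up // lerDl.
  have bs : blk i (ht q + s) = blk i (ht z).
    apply: blk_edge; rewrite hq lerDl s0 /= bottom_top.
    by rewrite ltrD2l lt_neqAle ne.
  right; split; [exact: stratum_up|by rewrite hs|].
  apply/funext => k; rewrite lab_up ?lerDl // -lq; have [ki|ik] := ltnP k i.
    by rewrite /mask qi //; case: ifP.
  by rewrite (mask_block ik) // bs.
- by move=> w [->|[]//]; exact: stratum_up.
Qed.

Lemma edge_half_open i z : @stratum R D i z -> half_open_segment (@stratum R D i) (edge i z).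
Proof.
move=> zi; have [q [eq hq hw]] := edge_bottom zi.
have qt : ht q < top i z by rewrite hq bottom_top ltrDl exp2_gt0.
have nt : ~ edge i z (up q (top i z)).
  by move=> [_ + _]; rewrite ht_up ?ltW // blk_mul; lia.
exists q, (up q (top i z)), (up q (top i z) |` edge i z); split.
- by move=> e; have := ht_up (ltW qt); rewrite -e; lra.
- exact: edge_segment.
- apply/seteqP; split=> w; first by move=> ew; split; [right|move=> /= e; apply: nt; rewrite -e].
  by move=> [[]].
Qed.

Lemma core_free i z : @stratum R D i z -> free_segment (@stratum R D i) (core i z).
Proof.
move=> zi; split; last exact: core_open.
have [q [eq hq hw]] := edge_bottom zi.
have uniq_node w : edge i z w -> node i w -> w = q.
  move=> ew [_ dw _]; have [_ bw lw] := ew; have [_ bq lq] := eq.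
  by apply: treeP; rewrite ?lw ?lq // hq dw bw.
have [nq|nq] := pselect (node i q); last first.
  right; suff -> : core i z = edge i z by exact: edge_half_open.
  apply/seteqP; split=> w; first by case.
  by move=> ew; split=> // nw; apply: nq; rewrite -(uniq_node w).
left; have [x [y [I [xy hI eE]]]] := edge_half_open zi.
have qt : ht q < top i z by rewrite hq bottom_top ltrDl exp2_gt0.
exists q, (up q (top i z)), (up q (top i z) |` edge i z); split.
- by move=> e; have := ht_up (ltW qt); rewrite -e; lra.
- exact: edge_segment.
- apply/seteqP; split=> w.
    move=> [ew nw]; split; first by right.
    case=> [wq|wt]; first by apply: nw; rewrite wq.
    have [_ + _] := ew; rewrite wt ht_up ?ltW // blk_mul; lia.
  move=> [[->|ew] nw]; first by exfalso; apply: nw; right.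
  by split=> // /(uniq_node w ew) wq; apply: nw; left.
Qed.

Lemma max_free_core i z : @stratum R D i z -> ~ node i z ->
  max_free_segment (@stratum R D i) (core i z).
Proof.
move=> zi nz; split=> [|S hS cS]; first exact: core_free.
have zc : core i z z by split.
by apply/seteqP; split=> //; apply: free_sub_core hS _; exact: cS.
Qed.

Lemma max_freeE i S : max_free_segment (@stratum R D i) S ->
  exists2 z, @stratum R D i z & S = core i z.
Proof.
move=> [hS mS]; have [z Sz] := free_segment_nonempty hS.
have zi := free_segment_sub hS Sz; exists z => //.
by apply/esym/mS; [exact: core_free|exact: free_sub_core].
Qed.

End Edges.

(** * The filtration is binary regular *)

Section Filtration.
Context {R : realType} (D : label_system).
Local Notation T := (@tree R D).
Local Notation F := (@stratum R D).
Implicit Types (x y z w p q v : T) (i j k l : nat).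

(** The upper bound holds because all points lie on one vertical line; the lower
    one is approached by points close to both ends. *)
Lemma core_diam i z : F i z -> ediam (core i z) = (2 ^+ i)%:E.
Proof.
move=> zi; have [q [eq hq hw]] := edge_bottom zi.
have [_ bq lq] := eq; have [qi _ _] := eq.
have b0 : 0 < 2 ^+ i :> R by exact: exp2_gt0.
apply/eqP; rewrite eq_le; apply/andP; split.
  apply: ge_ereal_sup => _ [x [ex _]] [y [ey _] <-]; rewrite lee_fin.
  rewrite (hw x ex) (hw y ey).
  have := blk_itv i (ht x); have := blk_itv i (ht y).
  have [_ -> _] := ex; have [_ -> _] := ey.
  rewrite -/(bottom i z) -/(top i z) bottom_top => /andP[y1 y2] /andP[x1 x2].
  rewrite mdist_up ?hq // ler_norml; apply/andP; split; lra.
apply/lee_addgt0Pr => e e0.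
pose d := Num.min e (2 ^+ i) / 3.
have [d0 de dj] : [/\ 0 < d, d * 3 <= e & d * 3 <= 2 ^+ i].
  have m0 : 0 < Num.min e (2 ^+ i) by rewrite lt_min e0.
  have me : Num.min e (2 ^+ i) <= e by rewrite ge_min lexx.
  have mj : Num.min e (2 ^+ i) <= 2 ^+ i by rewrite ge_min lexx orbT.
  by rewrite /d; split; lra.
have inner s : bottom i z < s -> s < top i z -> core i z (up q s).
  move=> s1 s2; have hs : ht (up q s) = s by rewrite ht_up // hq ltW.
  have bs : blk i s = blk i (ht z) by apply: blk_edge; rewrite ltW.
  split; last by move=> [_ + _]; rewrite hs /dyadic bs -/(bottom i z) => e1; lra.
  split; [exact: stratum_up|by rewrite hs|].
  apply/funext => k; rewrite lab_up ?hq ?(ltW s1) // -lq.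
  have [ki|ik] := ltnP k i; first by rewrite /mask qi //; case: ifP.
  by rewrite (mask_block ik) // bs bq.
have tE := bottom_top i z.
pose s1 := bottom i z + d; pose s2 := top i z - d.
have -> : (2 ^+ i : R) = (s2 - s1) + d *+ 2 by rewrite /s1 /s2 tE; ring.
have h1 : mdist (up q s2) (up q s1) = s2 - s1.
  by rewrite mdist_up ?hq ?ger0_norm // /s1 /s2; lra.
rewrite EFinD leeD //; last by rewrite lee_fin mulr2n; lra.
apply: ereal_sup_ubound; exists (up q s2); first by apply: inner; rewrite /s2; lra.
exists (up q s1); first by apply: inner; rewrite /s1; lra.
by rewrite h1.
Qed.

Lemma root_compatible i : compatible (@root_point R _ (@base D) i).
Proof.
move=> k j c c' _ /=; case: ifP => // _ [<-] _; exact: compat_base.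
Qed.

Definition root i : T := Tree (@proper_root R _ (@base D) i) (@root_compatible i).

Lemma label_not_node i z : lab z i <> None -> ~ node i z.
Proof. by move=> zi [_ di /(_ i zi)]. Qed.

Lemma edge_core i z : F i z -> lab z i <> None -> edge i z = core i z.
Proof.
move=> zi li; apply/seteqP; split=> [w ew|w []//]; split=> //.
by apply: label_not_node; have [_ _ ->] := ew.
Qed.

Lemma root_stratum i : F i (root i).
Proof. by move=> k ki; rewrite /= ki. Qed.

Lemma mesh_stratum i : mesh (F i) = (2 ^+ i)%:E.
Proof.
rewrite /mesh; have -> : [set ediam S | S in max_free_segment (F i)] = [set (2 ^+ i)%:E].
  apply/seteqP; split=> [_ [S hS <-]|_ ->].
    by have [z zi ->] := max_freeE hS; rewrite /= core_diam.
  exists (core i (root i)); last exact/core_diam/root_stratum.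
  apply: max_free_core; first exact: root_stratum.
  by apply: label_not_node; rewrite /= ltnn.
exact: ereal_inf1.
Qed.

Lemma not_stratumS i x : (F i `\` F i.+1) x <-> F i x /\ lab x i <> None.
Proof.
split=> -[xi h]; split=> //.
  move=> li; apply: h => k; rewrite ltnS leq_eqVlt => /orP[/eqP->//|]; exact: xi.
by move=> h1; apply: h; exact: h1.
Qed.

(** What disappears from the i-th stratum are its edges labelled on level i; their
    lower ends are tips, so they are maximal free and half-open. *)
Lemma stratum_diff i : exists C : set (set T),
    [/\ forall S, C S -> max_free_segment (F i) S /\ half_open_segment (F i) S,
        trivIset C id, uniformly_bounded C
      & F i `\` F i.+1 = \bigcup_(S in C) S].
Proof.
exists [set edge i z | z in F i `\` F i.+1]; split.
- move=> _ [z /not_stratumS[zi li] <-]; split; last exact: edge_half_open.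
  by rewrite edge_core //; apply: max_free_core => //; exact: label_not_node.
- move=> _ _ [z _ <-] [w _ <-] [x [/= zx wx]].
  by rewrite -(edge_sym zx) (edge_sym wx).
- exists (2 ^+ i) => _ [z /not_stratumS[zi li] <-] x y ex ey.
  rewrite -lee_fin -(core_diam zi) -edge_core //.
  by apply: ereal_sup_ubound; exists x => //; exists y.
- apply/seteqP; split=> [x hx|x [_ [z /not_stratumS[zi li] <-]]].
    by exists (edge i x); [exists x|apply: edge_refl; case: hx].
  by move=> [xi _ lx]; apply/not_stratumS; rewrite lx.
Qed.

Lemma stratum_binary_regular : binary_regular_filtration F.
Proof.
split; last exact: mesh_stratum.
split.
- exact: stratum0.
- by move=> i; exact: stratumW.
- exact: stratum_rtree.
- exact: stratum_bigcap.
- exact: stratum_diff.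
- by move=> i; rewrite !mesh_stratum lte_fin ltr_eXn2l // ltr1n.
- rewrite (_ : (fun i => mesh (F i)) = fun i => (2 ^+ i)%:E); last exact/funext/mesh_stratum.
  apply/cvgeryP; apply/cvgryPge => A; near=> n.
  have An : A <= n%:R by near: n; exact: nbhs_infty_ger.
  by apply: (le_trans An); rewrite -natrX ler_nat ltnW // ltn_expl.
Unshelve. all: by end_near. Qed.

End Filtration.

(** * The trees as locally finite graphs *)

Section Graph.
Context {R : realType} (D : label_system).
Local Notation T := (@tree R D).
Implicit Types (x y z w p q : T) (i j k l : nat).

Definition vertex := {x : T | `[< dyadic 0 (ht x) >]}.
Implicit Types (a b u v : vertex).

Definition parent x := up x (ht x + 1).

Definition adj u v := (val v == parent (val u)) || (val u == parent (val v)).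

Definition edge_point u v (t : R) :=
  if val v == parent (val u) then up (val u) (ht (val u) + t)
  else up (val v) (ht (val v) + 1 - t).

Lemma ht_parent x : ht (parent x) = ht x + 1.
Proof. by rewrite ht_up // lerDl. Qed.

Lemma vertexP u : dyadic 0 (ht (val u)).
Proof. by have /asboolP := valP u. Qed.

Lemma dyadic0E (t : R) : dyadic 0 t <-> t = (blk 0 t)%:~R.
Proof. by rewrite /dyadic expr0 mulr1. Qed.

Lemma dyadic0_int (m : int) : dyadic 0 (m%:~R : R).
Proof. by rewrite /dyadic -[X in blk 0 X]mulr1 -{3}(expr0 2) blk_mul expr0 mulr1. Qed.

Lemma vertex_ht u : exists n : nat, ht (val u) = n%:R.
Proof.
have /dyadic0E e := vertexP u; have [h0 _ _] := tree_proper (val u).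
have := blk_ge0 0 h0; move: e; case: (blk 0 _) => // n e _.
by exists n; rewrite e -pmulrn.
Qed.

Lemma make_vertex x : dyadic 0 (ht x) -> exists u, val u = x.
Proof. by move=> /asboolP dx; exists (Sub x dx). Qed.

Lemma parent_irr x y : x = parent y -> y = parent x -> False.
Proof.
move=> xy yx; have := ht_parent x; have := ht_parent y; rewrite -xy -yx.
by clear; lra.
Qed.

Lemma parent_ex u : exists v, val v = parent (val u).
Proof.
apply: make_vertex; rewrite ht_parent; have [n ->] := vertex_ht u.
by have := dyadic0_int n.+1; rewrite -pmulrn -natr1.
Qed.

Lemma adj_sym : symmetric adj.
Proof. by move=> u v; rewrite /adj orbC. Qed.

Lemma adj_irr : irreflexive adj.
Proof.
move=> u; rewrite /adj orbb; apply/negbTE/eqP => e.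
by have := ht_parent (val u); rewrite -e; lra.
Qed.

Lemma reach_ancestor u n : exists v, val v = up (val u) (ht (val u) + n%:R) /\
  (exists2 p, path adj u p & last u p = v) /\ (exists2 p, path adj v p & last v p = u).
Proof.
elim: n => [|n [v [ev [[p p1 p2] [q q1 q2]]]]].
  exists u; split; first by rewrite addr0 up_le.
  by split; exists [::].
have [v' ev'] := parent_ex v.
have vv : adj v v' by rewrite /adj ev' eqxx.
exists v'; split.
  rewrite ev' /parent ev up_up; first by rewrite ht_up ?lerDl // -addrA natr1.
  by rewrite ht_up ?lerDl // -addrA natr1 lerD2l ler_nat.
split; first by exists (rcons p v'); rewrite ?rcons_path ?last_rcons // p1 p2.
by exists (v :: q) => //=; rewrite adj_sym vv.
Qed.

Lemma adj_connected : connected_graph adj.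
Proof.
move=> u v; have [a ha] := vertex_ht u; have [b hb] := vertex_ht v.
have [um vm] := meet_hts (val u) (val v).
have m0 : 0 <= meet_ht (val u) (val v) by apply: le_trans um; rewrite ha.
pose M := Num.bound (meet_ht (val u) (val v)).
have hM : meet_ht (val u) (val v) <= M%:R by apply/ltW/archi_boundP.
have eM : up (val u) M%:R = up (val v) M%:R.
  exact/up_meets/(meets_up (meets_mu _ _)).
have aM : (a <= M)%N by rewrite -(ler_nat R) -ha (le_trans um).
have bM : (b <= M)%N by rewrite -(ler_nat R) -hb (le_trans vm).
have [w [ew [[p p1 p2] _]]] := reach_ancestor u (M - a).
have [w' [ew' [_ [q q1 q2]]]] := reach_ancestor v (M - b).
have ww : w = w'.
  by apply: val_inj; rewrite ew ew' ha hb -!natrD !subnKC.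
by exists (p ++ q); rewrite ?cat_path ?last_cat p2 ww // p1.
Qed.

(** In a cycle, both neighbours of a lowest vertex would be its parent. *)
Lemma adj_acyclic : acyclic_graph adj.
Proof.
move=> c sc /andP[cyc unq].
have [w wc wmin] : exists2 w, w \in c & forall v, v \in c -> ht (val w) <= ht (val v).
  have : (0 < size c)%N by exact: leq_ltn_trans sc.
  elim: c {sc cyc unq} => // u [_ _|v c IH _].
    by exists u; rewrite ?mem_head // => v; rewrite inE => /eqP->.
  have [//|w wc wmin] := IH.
  have [uw|wu] := leP (ht (val u)) (ht (val w)).
    exists u; rewrite ?mem_head // => z; rewrite inE => /orP[/eqP->//|/wmin].
    exact: le_trans.
  exists w; first by rewrite inE wc orbT.
  by move=> z; rewrite inE => /orP[/eqP->|/wmin//]; exact: ltW.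
have [i s es] := rot_to wc.
have up_w v : v \in c -> adj w v -> val v = parent (val w).
  move=> vc /orP[/eqP//|/eqP e]; have := wmin v vc.
  by have := ht_parent (val v); rewrite -e => ->; rewrite gerDl ler10.
have : cycle adj (w :: s) by rewrite -es rot_cycle.
have : uniq (w :: s) by rewrite -es rot_uniq.
have : (2 < size (w :: s))%N by rewrite -es size_rot.
have mem_c v : v \in s -> v \in c by move=> vs; rewrite -(mem_rot i) es inE vs orbT.
case: s es mem_c => // x s es mem_c /= ss /and3P[_ xs _] /andP[wx].
rewrite rcons_path => /andP[_ lw].
have lc : last x s \in x :: s by rewrite mem_last.
have e : last x s = x.
  apply: val_inj; rewrite (up_w x) ?mem_c ?mem_head //.
  by apply: up_w; [exact: mem_c|rewrite adj_sym].
case: s ss xs {es mem_c lw lc} e => // y s _ xs /= e.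
by move: xs; rewrite -{1}e mem_last.
Qed.

(** The height h of a vertex with children is an odd multiple of some 2 ^ j;
    below the vertex only the label of level j can change. *)
Lemma adj_locally_finite : locally_finite_graph adj.
Proof.
move=> u; pose children := [set v : vertex | parent (val v) = val u].
have [p ep] := parent_ex u.
suff fc : finite_set children.
  apply: (@sub_finite_set _ _ ([set p] `|` children)); last by rewrite finite_setU; split.
  by move=> v /= /orP[/eqP e|/eqP e]; [left; apply: val_inj; rewrite ep|right].
have [[v0 cv0]|none] := pselect (exists v, children v); last first.
  rewrite (_ : children = set0) //; apply/seteqP; split=> // v cv.
  by exfalso; apply: none; exists v.
have nu : node 0 (val u).
  rewrite -cv0; apply: node_up => //; first by rewrite ltrDl.
  by rewrite -ht_parent cv0; exact: vertexP.
have [j [m [_ hu uj]]] := node_odd nu.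
have [l [jl ul]] := label_ex (val u) j.+1.
pose S := None |` Some @` [set c | @compat D j c l (@base D l)].
have ch v : children v -> [/\ ht (val v) = ht (val u) - 1,
    S (lab (val v) j), forall k, (k < j)%N -> lab (val v) k = None
    & forall k, (j < k)%N -> lab (val v) k = lab (val u) k].
  move=> cv; have hv : ht (val v) = ht (val u) - 1.
    by rewrite -cv ht_parent addrK.
  have hk k : (j < k)%N -> lab (val v) k = lab (val u) k.
    move=> jk; rewrite -cv lab_up ?lerDl // -ht_parent cv (@mask_block _ _ _ j.+1) //.
    rewrite (blk_hang_top hu) hv.
    suff [_ ->] : blk j (ht (val u) - 1) = m * 2 /\ blk j.+1 (ht (val u) - 1) = m by [].
    by apply: blk_odd; rewrite hu; have := exp2_ge1 (R := R) j; move=> ?; apply/andP; split; lra.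
  split=> //.
    case e : (lab (val v) j) => [c|]; last by left.
    right; exists c => //=; apply: tree_compatible e _; first exact: jl.
    by rewrite hk.
  move=> k kj; apply: contrapT => vk.
  have [_ dv _] := tree_proper (val v); have := dv k vk.
  have e : ht (val v) = ((m * 2 + 1) * 2 ^+ (j - k) : int)%:~R * 2 ^+ k - 1.
    by rewrite hv hu (dyadicM _ (ltnW kj)).
  have b : blk k (ht (val v)) = (m * 2 + 1) * 2 ^+ (j - k) - 1.
    apply/blkP; rewrite e subrK rmorphB /= mulrBl mul1r.
    by have ? := exp2_ge1 (R := R) k; apply/andP; split; lra.
  rewrite /digit0 b (_ : (j - k)%N = (j - k.+1).+1) ?exprS; last by lia.
  by clear; lia.
pose g o := xget u [set v | children v /\ lab (val v) j = o].
apply: (@sub_finite_set _ _ (g @` S)); last first.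
  apply: finite_image; rewrite finite_setU; split=> //.
  apply: finite_image; exact: compat_finite.
move=> v cv; have [hv Sv z0 z1] := ch v cv; exists (lab (val v) j) => //.
have [] : [set w | children w /\ lab (val w) j = lab (val v) j] (g (lab (val v) j)).
  by apply: xgetPex; exists v.
move: (g _) => w /= cw lw.
have [hw _ w0 w1] := ch w cw; apply: val_inj; apply: treeP; first by rewrite hw hv.
by move=> k; have [kj|jk|->//] := ltngtP k j; [rewrite w0 // z0|rewrite w1 // z1].
Qed.

Lemma edge_pointP u v t : adj u v ->
  (val v = parent (val u) /\ edge_point u v t = up (val u) (ht (val u) + t)) \/
  (val u = parent (val v) /\ edge_point u v t = up (val v) (ht (val v) + (1 - t))).
Proof.
rewrite /adj /edge_point; case: eqP => [->|_ /= /eqP ->]; [by left|right].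
by rewrite addrA.
Qed.

Lemma edge_point_inner u v t : adj u v -> t \in `]0, 1[ ->
  exists a s, [/\ s \in `]0, 1[, edge_point u v t = up (val a) (ht (val a) + s)
    & (a = u /\ val v = parent (val u)) \/ (a = v /\ val u = parent (val v))].
Proof.
move=> uv tin; have [[e1 e2]|[e1 e2]] := edge_pointP t uv.
  by exists u, t; split=> //; left.
exists v, (1 - t); split=> //; last by right.
by move: tin; rewrite !in_itv /= => /andP[? ?]; apply/andP; split; lra.
Qed.

Lemma blk0_inner a (s : R) : 0 <= s < 1 -> blk 0 (ht (val a) + s) = blk 0 (ht (val a)).
Proof.
move=> /andP[s0 s1]; have /dyadic0E e := vertexP a.
by apply/blkP; rewrite expr0 !mulr1 intrD -e; apply/andP; split; lra.
Qed.

(** A point in the interior of an edge determines the lower end of the edge, since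
    labels change at integer heights only. *)
Lemma inner_inj a b (s t : R) : s \in `]0, 1[ -> t \in `]0, 1[ ->
  up (val a) (ht (val a) + s) = up (val b) (ht (val b) + t) -> a = b.
Proof.
rewrite !in_itv /= => /andP[s0 s1] /andP[t0 t1] e.
have sin : 0 <= s < 1 by rewrite ltW. have tin : 0 <= t < 1 by rewrite ltW.
have he : ht (val a) + s = ht (val b) + t.
  by have := congr1 (fun x => ht (tval x)) e; rewrite !ht_up ?lerDl ?ltW.
have be : blk 0 (ht (val a)) = blk 0 (ht (val b)).
  by rewrite -(blk0_inner a sin) he blk0_inner.
apply: val_inj; apply: treeP => [|k].
  by rewrite (iffLR (dyadic0E _) (vertexP a)) be -(iffLR (dyadic0E _) (vertexP b)).
have := congr1 (fun x => lab (tval x) k) e; rewrite !lab_up ?lerDl ?(ltW s0) ?(ltW t0) //.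
by rewrite !(mask_block (leq0n k)) // blk0_inner.
Qed.

Local Notation chain := (chain adj edge_point).
Local Notation common := (on_common_edge adj edge_point).

Lemma common_sym x y : common x y -> common y x.
Proof. by case=> u [v [s [t [uv sin tin ex ey]]]]; exists u, v, t, s. Qed.

Lemma chain_cat x y z (l m : R) : chain x y l -> chain y z m -> chain x z (l + m).
Proof.
move=> c; elim: c z m => [{}x|{}x {}y w {}l xy _ IH] z m h; first by rewrite add0r.
by rewrite -addrA; apply: chain_cons xy (IH _ _ h).
Qed.

Lemma chain_sym x y (l : R) : chain x y l -> chain y x l.
Proof.
elim=> [{}x|{}x {}y w {}l xy _ IH]; first exact: chain_nil.
rewrite addrC metric_sym -[mdist y x]addr0.
apply: chain_cat IH _; apply: chain_cons (chain_nil _ _ _); exact: common_sym.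
Qed.

Lemma chain_ge x y (l : R) : chain x y l -> mdist x y <= l.
Proof.
elim=> [{}x|{}x {}y w {}l xy _ IH]; first by rewrite mdistxx.
by apply: le_trans (metric_triangle _ y _) _; rewrite lerD2l.
Qed.

Lemma common_up x (h : R) : ht x <= h -> h <= top 0 x -> common x (up x h).
Proof.
move=> xh ht1; have x0 : stratum 0 x by rewrite stratum0.
have [q [eq hq hw]] := edge_bottom x0.
have xq := hw x (edge_refl x0).
have [u eu] : exists u, val u = q.
  by apply: make_vertex; rewrite hq /bottom expr0 mulr1; exact: dyadic0_int.
have [v ev] := parent_ex u.
have /andP[qx xt] := ht_edge 0 x; move: ht1 xt; rewrite bottom_top expr0 -hq => ht1 xt.
rewrite -hq in qx.
exists u, v, (ht x - ht q), (h - ht q).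
rewrite /edge_point ev eqxx eu !in_itv /= !(addrC (ht q)) !subrK; split.
- by rewrite /adj ev eqxx.
- by apply/andP; split; lra.
- by apply/andP; split; lra.
- exact: xq.
- by rewrite {1}xq up_up.
Qed.

Lemma chain_up n x (h : R) : ht x <= h -> h <= bottom 0 x + n%:R -> chain x (up x h) (h - ht x).
Proof.
elim: n x => [|n IH] x xh hn.
  have /andP[bx _] := ht_edge 0 x.
  have -> : h = ht x by apply/eqP; rewrite eq_le xh andbT; lra.
  by rewrite up_le // subrr; exact: chain_nil.
have /andP[bx xt] := ht_edge 0 x.
have [ht1|th] := leP h (top 0 x).
  rewrite -(mdist_up1 xh) -[mdist _ _]addr0; apply: chain_cons (chain_nil _ _ _).
  exact: common_up.
set y := up x (top 0 x); have hy : ht y = top 0 x by rewrite ht_up // ltW.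
have -> : h - ht x = mdist x y + (h - ht y) by rewrite mdist_up1 ?hy ?ltW //; ring.
rewrite -(up_up _ (ltW th)); apply: chain_cons.
  by apply: common_up => //; exact: ltW.
apply: IH; first by rewrite hy ltW.
rewrite /bottom hy (_ : blk 0 (top 0 x) = blk 0 (ht x) + 1); last by rewrite blk_mul.
by rewrite -/(top 0 x) bottom_top expr0; rewrite -natr1 in hn; lra.
Qed.

Lemma chain_ex x y : chain x y (mdist x y).
Proof.
have up_ex z (h : R) : ht z <= h -> chain z (up z h) (h - ht z).
  move=> zh; have [z0 _ _] := tree_proper z.
  apply: (@chain_up (Num.bound h)) => //.
  have := archi_boundP (le_trans z0 zh).
  have : 0 <= bottom 0 z by rewrite mulr_ge0 // ler0z blk_ge0.
  lra.
have [xm ym] := meet_hts x y.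
have -> : mdist x y = (meet_ht x y - ht x) + (meet_ht x y - ht y).
  by rewrite mdistE /tdist; ring.
apply: chain_cat (up_ex x _ xm) _.
by rewrite (up_meets (meets_mu x y)); exact: chain_sym (up_ex y _ ym).
Qed.

Lemma tree_realization : geometric_realization adj val edge_point.
Proof.
split.
- exact: val_inj.
- move=> u v uv; have [[_ ->]|[-> ->]] := edge_pointP 0 uv; first by rewrite addr0 up_le.
  by rewrite subr0.
- move=> u v t uv _; have vu : adj v u by rewrite adj_sym.
  have [[e1 e2]|[e1 e2]] := edge_pointP (1 - t) uv;
    have [[e3 e4]|[e3 e4]] := edge_pointP t vu; rewrite e2 e4 ?subKr //.
    by case: (parent_irr e1 e3).
  by case: (parent_irr e1 e3).
- move=> u v uv s t; rewrite !in_itv /= => /andP[s0 s1] /andP[t0 t1].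
  have [[e1 e2]|[e1 e2]] := edge_pointP s uv; have [[e3 e4]|[e3 e4]] := edge_pointP t uv.
  + by rewrite e2 e4 mdist_up ?lerDl //; congr (`|_|); ring.
  + by case: (parent_irr e1 e3).
  + by case: (parent_irr e1 e3).
  + by rewrite e2 e4 mdist_up ?lerDl ?subr_ge0 // distrC; congr (`|_|); ring.
- move=> x; right; have x0 : stratum 0 x by rewrite stratum0.
  have /andP[_ xt] := ht_edge 0 x.
  have [u [v [s [t [uv sin tin ex _]]]]] := common_up (lexx (ht x)) (ltW xt).
  by exists u, v, s.
- move=> u v w t uv tin; have [a [s [sin -> _]]] := edge_point_inner uv tin.
  move: sin; rewrite in_itv /= => /andP[s0 s1] e.
  have hw : ht (val a) + s = ht (val w).
    by have := congr1 (@ht R (lbl D) \o @tval R D) e; rewrite -[LHS]/(ht (up _ _)) ht_up ?lerDl ?ltW.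
  have /dyadic0E := vertexP w; have /dyadic0E := vertexP a.
  rewrite -hw blk0_inner ?ltW // => <-; move: s0 s1; clear; lra.
- move=> u v u' v' s t uv uv' sin tin.
  have [a [s' [sin' -> ha]]] := edge_point_inner uv sin.
  have [b [t' [tin' -> hb]]] := edge_point_inner uv' tin.
  move=> /(inner_inj sin' tin') ab.
  case: ha hb => -[ea pa] [] [eb pb].
  + by left; split; [rewrite -ea -eb|apply: val_inj; rewrite pa pb -ea -eb ab].
  + by right; split; [rewrite -ea -eb|apply: val_inj; rewrite pa pb -ea -eb ab].
  + by right; split; [apply: val_inj; rewrite pa pb -ea -eb ab|rewrite -ea -eb].
  + by left; split; [apply: val_inj; rewrite pa pb -ea -eb ab|rewrite -ea -eb].
- move=> x y; apply/eqP; rewrite eq_le; apply/andP; split.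
    by apply: lb_le_inf; [exists (mdist x y); exact: chain_ex|move=> l /chain_ge].
  apply: ge_inf; last exact: chain_ex.
  by exists (mdist x y) => l /chain_ge.
Qed.

Lemma tree_locally_finite : locally_finite_tree T.
Proof.
exists vertex, adj; split; last by exists val, edge_point; exact: tree_realization.
- by split; [exact: adj_sym|exact: adj_irr|exact: adj_connected|exact: adj_acyclic].
- exact: adj_locally_finite.
Qed.

End Graph.

(** * Canonical retractions *)

Section Retraction.
Context {R : realType} (D : label_system).
Local Notation T := (@tree R D).
Local Notation F := (@stratum R D).
Implicit Types (v w x y z p q : T) (i j k l : nat).

Lemma up_lipschitz x (s t : R) : mdist (up x s) (up x t) <= `|s - t|.
Proof.
wlog st : s t / s <= t => [hw|].
  have [/hw->//|/ltW ts] := leP s t.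
  by rewrite metric_sym distrC hw.
have [xs|sx] := leP (ht x) s; first by rewrite mdist_up // (le_trans xs).
rewrite (up_le (ltW sx)); have [xt|tx] := leP (ht x) t.
  by rewrite mdist_up1 // ler0_norm ?subr_le0 //; lra.
by rewrite up_le ?mdistxx // ltW.
Qed.

Lemma up_continuous x : continuous (up x : R -> T).
Proof.
move=> s; apply/metricType_numDomainType.cvgrPdist_lt => e e0; near=> t.
apply: le_lt_trans (up_lipschitz x s t) _.
by near: t; exact: cvgr_dist_lt.
Unshelve. all: by end_near. Qed.

Lemma vertical_connected x (s t : R) : connected [set up x u | u in `[s, t]].
Proof.
apply: connected_continuous_connected; first exact: segment_connected.
by apply: continuous_subspaceT; exact: up_continuous.
Qed.

Lemma closure_near (A : set T) p :
  (forall e : R, 0 < e -> exists2 w, A w & mdist p w < e) -> closure A p.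
Proof.
move=> h B /nbhs_ballP[e /= e0 eB]; have [w Aw pw] := h e e0.
by exists w; split=> //; apply: eB; rewrite ballEmdist.
Qed.

Lemma open_near (A : set T) :
  (forall w, A w -> exists2 e : R, 0 < e & forall v, mdist w v < e -> A v) -> open A.
Proof.
move=> h; rewrite openE => w /h[e e0 he]; apply/nbhs_ballP.
by exists e => //= v; rewrite ballEmdist; exact: he.
Qed.

Section Branch.
Variables (k : nat) (x : T).
Hypothesis xk : lab x k <> None.

Let h : R := top k x.
Let p : T := up x h.

(* The branch of level k through x, together with all that hangs from it; it
   will turn out to be the component of x in the complement of the next
   stratum. *)
Let B : set T := [set w | blk k (ht w) = blk k (ht x) /\
  forall l, (k <= l)%N -> lab w l = lab x l].

Let xh : ht x < h. Proof. by have /andP[] := ht_edge k x. Qed.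

Let hdy l : (l <= k)%N -> dyadic l h.
Proof. by move=> lk; exact: dyadicW lk (dyadic_top k x). Qed.

Let htp : ht p = h. Proof. by rewrite ht_up // ltW. Qed.

Let B_lt w : B w -> ht w < h.
Proof. by move=> [bw _]; rewrite /h /top -bw; have /andP[] := blk_itv k (ht w). Qed.

Let low w l : ht w < h -> (l <= k)%N -> mask w h l = None.
Proof.
move=> wh lk; rewrite /mask; case: eqP => // e.
by have := dyadic_le (hdy lk) wh; rewrite e ltxx.
Qed.

Let p_stratum : F k.+1 p.
Proof. by move=> l lk; rewrite lab_up ?ltW // low. Qed.

Let blk_high w l : B w -> (k < l)%N -> blk l h = blk l (ht w).
Proof.
move=> [bw _] kl; apply: eq_blk kl _; apply/eqP.
have hk : blk k h = blk k (ht x) + 1 by rewrite blk_mul.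
have [_ xd _] := tree_proper x; have := xd k xk; rewrite /digit0 => dx.
have := blk_div2 k h; have := blk_div2 k (ht w); rewrite hk bw dx; lia.
Qed.

Let up_B w : B w -> up w h = p.
Proof.
move=> Bw; have [bw lw] := Bw; have Bx : B x by [].
apply: treeP => [|l]; first by rewrite htp ht_up // ltW // B_lt.
rewrite !lab_up ?(ltW (B_lt _)) ?(ltW xh) //; have [lk|kl] := leqP l k.
  by rewrite !low // B_lt.
by rewrite /mask (blk_high Bw) // -(blk_high Bx) // (blk_high Bw) // eqxx lw // ltnW.
Qed.

(* A branch of level l < k ends at an odd multiple of 2 ^ l, whereas h is a
   multiple of 2 ^ (l + 1); so the branch ends at least one unit below h. *)
Let last_unit w (s : R) l : ht w <= s -> h - 1 <= s < h -> (l < k)%N -> mask w s l = None.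
Proof.
move=> ws /andP[hs sh] lk; rewrite /mask; case: eqP => // e; apply: contrapT => wl.
have [_ wd _] := tree_proper w; have ds := eq_digit0 (leqnn l) e (wd l wl).
have := digit0_gap ds; have := dyadic_le (hdy lk) sh; rewrite -lezD1.
rewrite -(ler_int R) -(ler_pM2r (exp2_gt0 l.+1)) -(hdy lk).
by have := exp2_ge1 (R := R) l; lra.
Qed.

Let B_up w (s : R) : B w -> ht w <= s < h -> B (up w s).
Proof.
move=> [bw lw] /andP[ws sh].
have bs : blk k s = blk k (ht x).
  apply: blk_edge; rewrite sh andbT; apply: le_trans ws.
  by rewrite /bottom -bw; have /andP[] := blk_itv k (ht w).
split; first by rewrite ht_up.
by move=> l kl; rewrite lab_up // (mask_block kl) ?lw // bs.
Qed.

(* A line that merges with the line of w below h is in the branch, because only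
   lines that carry its label can enter it. *)
Let meet_B w v : B w -> meet_ht v w < h -> B v.
Proof.
move=> Bw mh; have [bw lw] := Bw; have [vm wm em] := meets_mu v w.
have bm : blk k (meet_ht v w) = blk k (ht w).
  have mm : ht w <= meet_ht v w < h by rewrite wm.
  by have [] := B_up Bw mm; rewrite ht_up // bw.
have bv : blk k (meet_ht v w) = blk k (ht v).
  have := em k; rewrite (mask_block (leqnn k) bm) lw // /mask.
  by case: eqP => // _ /esym.
split; first by rewrite -bv bm.
by move=> l kl; have := em l; rewrite (mask_block kl bm) (mask_block kl bv) lw.
Qed.

Let B_open : open B.
Proof.
apply: open_near => w Bw; exists (h - ht w); first by rewrite subr_gt0 B_lt.
move=> v wv; apply: meet_B Bw _; rewrite meet_htC.
by have := meet_hts w v; move: wv; rewrite mdistE /tdist => ? [? ?]; lra.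
Qed.

Let B_dist w v : B w -> ~ B v -> mdist v p <= mdist v w.
Proof.
move=> Bw nv; have hm : h <= meet_ht v w.
  by rewrite leNgt; apply/negP => /(meet_B Bw).
have [vm wm em] := meets_mu v w.
have pm : meet_ht v p <= meet_ht v w.
  apply: meet_ht_le; apply: meets_up_eq => //; first by rewrite htp.
  by rewrite -(up_B Bw) up_up // (up_meets (meets_mu v w)).
by rewrite !mdistE /tdist htp; have := B_lt Bw; lra.
Qed.

Let Bp_closed : closed (p |` B).
Proof.
rewrite -(setCK (p |` B)); apply: open_closedC; apply: open_near => v nv.
have nB : ~ B v by move=> Bv; apply: nv; right.
exists (mdist v p); first by rewrite mdist_gt0; apply/eqP => e; apply: nv; left.
by move=> w vw [/= wp|Bw]; [rewrite wp ltxx in vw|have := B_dist Bw nB; lra].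
Qed.

Let B_out w : B w -> ~ F k.+1 w.
Proof. by move=> [_ lw] /(_ k (ltnSn k)); rewrite lw. Qed.

(* Vertical segments starting at x and at w merge just below h. *)
Let B_connected w : B w -> exists A : set T, [/\ connected A, A `<=` B, A x & A w].
Proof.
move=> Bw; have Bx : B x by [].
pose s := Num.max (Num.max (ht w) (ht x)) (h - 1).
have ws : ht w <= s by rewrite !le_max lexx.
have xs : ht x <= s by rewrite !le_max lexx orbT.
have hs : h - 1 <= s < h.
  by rewrite le_max lexx orbT /= !gt_max B_lt //= xh /= gtrDl; lra.
have sh : s < h by case/andP: hs.
have e : up w s = up x s.
  have [_ lw] := Bw; apply: treeP => [|l]; first by rewrite !ht_up.
  have [lk|kl] := ltnP l k; first by rewrite !lab_up // !last_unit.
  have ws' : ht w <= s < h by rewrite ws. have xs' : ht x <= s < h by rewrite xs.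
  have [_ e1] := B_up Bw ws'; have [_ e2] := B_up Bx xs'.
  by rewrite e1 // e2.
exists ([set up w u | u in `[ht w, s]] `|` [set up x u | u in `[ht x, s]]); split.
- apply: connectedU; [|exact: vertical_connected|exact: vertical_connected].
  exists (up w s); split; first by exists s; rewrite //= in_itv /= lexx andbT.
  by exists s; rewrite ?e //= in_itv /= lexx andbT.
- by move=> v [] [u /=]; rewrite in_itv /= => /andP[u1 u2] <-; apply: B_up => //;
    rewrite u1 /= (le_lt_trans u2).
- by right; exists (ht x); rewrite ?up_le //= in_itv /= lexx xs.
- by left; exists (ht w); rewrite ?up_le //= in_itv /= lexx ws.
Qed.

Let component_branch : connected_component (~` F k.+1) x = B.
Proof.
have Bx : B x by [].
apply/seteqP; split=> [w [A [Ax AF cA] Aw]|w Bw].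
  have AB : A `&` B = A; last by move: Aw; rewrite -AB => -[].
  apply: cA; first by exists x.
    by exists B.
  exists (p |` B) => //; apply/seteqP; split=> v [Av]; first by split=> //; right.
  by move=> [vp|//]; case: (AF _ Av); rewrite vp.
have [A [cA AB Ax Aw]] := B_connected Bw.
by exists A => //; split=> // v /AB; exact: B_out.
Qed.

Let near_p (e : R) : 0 < e -> exists w, [/\ B w, F k w & mdist p w < e].
Proof.
move=> e0; have Bx : B x by [].
pose s := Num.max (Num.max (ht x) (h - 1)) (h - e / 2).
have hs : ht x <= s < h by rewrite !le_max lexx /= !gt_max xh /=; apply/andP; split; lra.
have sh : s < h by case/andP: hs.
have xs : ht x <= s by case/andP: hs.
have h1 : h - 1 <= s < h by rewrite sh andbT !le_max lexx orbT.
exists (up x s); split; first exact: B_up.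
  by move=> l lk; rewrite lab_up // last_unit.
rewrite /p mdist_up // ?(ltW xh) // ger0_norm ?subr_ge0 ?(ltW sh) //.
have : h - e / 2 <= s by rewrite le_max lexx orbT.
lra.
Qed.

Let branch_boundary : boundary_in setT B = [set p].
Proof.
rewrite /boundary_in setTI setTD; apply/seteqP; split=> [v [cB cC]|_ ->].
  have nB : ~ B v.
    have : closed (~` B) by exact: open_closedC.
    by move/closure_id => E; move: cC; rewrite -E.
  have : (p |` B) v; last by case.
  have -> := iffLR (closure_id _) Bp_closed.
  by apply: closureS cB => w; right.
split; last by apply: subset_closure => /B_out.
by apply: closure_near => e /near_p[w [Bw _ pw]]; exists w.
Qed.

Lemma retraction_branch : canonical_retraction (F k.+1) x = p.
Proof.
rewrite /canonical_retraction; case: ifPn => [|_].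
  by rewrite in_setE => /(_ k (ltnSn k)).
rewrite component_branch branch_boundary.
have : [set y : T | [set p] = [set y]] (xget x [set y : T | [set p] = [set y]]).
  by apply: xgetPex; exists p.
by move=> /= /seteqP[/(_ p erefl) /esym].
Qed.

Lemma retraction_boundary :
  boundary_in (F k) (F k `\` F k.+1) (canonical_retraction (F k.+1) x).
Proof.
rewrite retraction_branch; have pk : F k p by exact: stratumW (leqnSn k) _ p_stratum.
split; first split=> //.
  apply: closure_near => e /near_p[w [Bw wk pw]]; exists w => //.
  by split=> //; exact: B_out.
by apply: subset_closure; split=> // -[].
Qed.

End Branch.
End Retraction.

(** A label on level k means that the line of x i ascends through a branch of
    level k, and the retraction sends x i to the point from which it hangs. *)
Lemma tree_M_space {R : realType} n (D : 'I_n.+1 -> label_system)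
    (x : forall i, @tree R (D i)) :
  (forall k, exists i, lab (x i) k <> None) ->
  M_space (fun i => @stratum R (D i)) x.
Proof.
move=> h [|k] //= _; have [i hi] := h k; exists i.
exact: retraction_boundary.
Qed.

(** * Attaching the members of one cover *)

Section Collar.
Context {R : realType} {X : metricType R}.
Implicit Types (C : set X) (x y z : X).

Definition set_dist C x := inf [set mdist x y | y in C].

Lemma set_dist_le C x y : C y -> set_dist C x <= mdist x y.
Proof. by move=> Cy; apply: ge_inf; [exists 0 => _ [z _ <-]; exact: mdist_ge0|exists y]. Qed.

Lemma set_dist_ge C x (r : R) : C !=set0 -> (forall y, C y -> r <= mdist x y) -> r <= set_dist C x.
Proof.
move=> [y Cy] h; apply: lb_le_inf; first by exists (mdist x y), y.
by move=> _ [z Cz <-]; exact: h.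
Qed.

Lemma set_dist_triangle C x y : C !=set0 -> set_dist C x <= mdist x y + set_dist C y.
Proof.
move=> C0; rewrite -lerBlDl; apply: set_dist_ge => // z Cz.
by rewrite lerBlDl; apply: le_trans (set_dist_le x Cz) (metric_triangle _ _ _).
Qed.

Variable e : R.
Hypothesis e0 : 0 < e.

(** The cut-off function of C; its support is called the collar of C below. *)
Definition bump C x := Num.max 0 (1 - set_dist C x / e).

Lemma bump_in C x : C x -> bump C x = 1.
Proof.
move=> Cx; rewrite /bump; have -> : set_dist C x = 0.
  apply/eqP; rewrite eq_le -{1}(mdistxx x) set_dist_le //=.
  by apply: set_dist_ge => [|y _]; [exists x|exact: mdist_ge0].
by rewrite mul0r subr0 max_r.
Qed.

Lemma bump_le1 C x : C !=set0 -> bump C x <= 1.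
Proof.
move=> C0; rewrite /bump ge_max ler01 /= gerBl divr_ge0 ?(ltW e0) //.
by apply: set_dist_ge => // y _; exact: mdist_ge0.
Qed.

Lemma bump_ge0 C x : 0 <= bump C x.
Proof. by rewrite /bump le_max lexx. Qed.

Lemma bump_lip C x y : C !=set0 -> bump C x <= bump C y + mdist x y / e.
Proof.
move=> C0; rewrite /bump ge_max; apply/andP; split.
  by rewrite addr_ge0 ?le_max ?lexx // divr_ge0 ?mdist_ge0 ?(ltW e0).
have h1 : 1 - set_dist C y / e <= Num.max 0 (1 - set_dist C y / e).
  by rewrite le_max lexx orbT.
apply: le_trans (lerD h1 (lexx _)).
have := set_dist_triangle y x C0; rewrite (metric_sym y x).
by rewrite -(ler_pM2r (x := e^-1)) ?invr_gt0 // mulrDl; lra.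
Qed.

Lemma bump_lip_norm C x y : C !=set0 -> `|bump C x - bump C y| <= mdist x y / e.
Proof.
move=> C0; have h1 := bump_lip x y C0; have h2 := bump_lip y x C0.
by rewrite (metric_sym y x) in h2; rewrite ler_norml; apply/andP; split; lra.
Qed.

Lemma bump_near C x : 0 < bump C x -> C !=set0 -> exists2 y, C y & mdist x y < e.
Proof.
move=> b0 C0; apply: contrapT => H.
have : e <= set_dist C x.
  apply: set_dist_ge => // y Cy; rewrite leNgt; apply/negP => xy; apply: H.
  by exists y.
rewrite -(ler_pM2r (x := e^-1)) ?invr_gt0 // mulfV ?gt_eqF // => h.
by move: b0; rewrite /bump lt_max ltxx /=; lra.
Qed.

End Collar.

Lemma max_dist_le {R : realType} (a b c d : R) :
  `|Num.max a b - Num.max c d| <= `|a - c| + `|b - d|.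
Proof.
have := ler_norm (a - c); have := ler_norm (c - a); rewrite (distrC c a).
have := ler_norm (b - d); have := ler_norm (d - b); rewrite (distrC d b).
move=> h1 h2 h3 h4; rewrite ler_norml.
by have [?|?] := leP a b; have [?|?] := leP c d; apply/andP; split; lra.
Qed.

Section Attach.
Context {R : realType} {L : Type}.
Variable base : nat -> L.
Local Notation lpoint := (lpoint R L).
Implicit Types (a x : lpoint) (c : L) (q k : nat).

Definition span q : R := 2 ^+ q.*2.+1.

(** The height at which new branches are attached above a: the least odd
    multiple of the span beyond ht a + 1.  At such a height no later, finer
    branch is attached, and the whole image of a small set lies below it. *)
Definition attach q a : R := (blk q.*2.+2 (ht a + 1 + span q) * 2 + 1)%:~R * span q.

Lemma spanE q : 2 ^+ q.*2.+2 = 2 * span q.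
Proof. exact: exprS. Qed.

Lemma span_ge2 q : 2 <= span q.
Proof. by rewrite /span exprS ler_peMr // exp2_ge1. Qed.

Lemma attach_gt q a : ht a + 1 < attach q a.
Proof.
have /andP[_] := blk_itv q.*2.+2 (ht a + 1 + span q).
rewrite /attach spanE !intrD !intrM; lra.
Qed.

Lemma attach_le q a : attach q a <= ht a + 1 + span q * 2.
Proof.
have /andP[+ _] := blk_itv q.*2.+2 (ht a + 1 + span q).
rewrite /attach spanE !intrD !intrM; lra.
Qed.

Lemma attach_min q a (m : int) : ht a + 1 < (m * 2 + 1)%:~R * span q ->
  attach q a <= (m * 2 + 1)%:~R * span q.
Proof.
move=> h; rewrite /attach ler_pM2r ?exp2_gt0 // ler_int.
have : blk q.*2.+2 (ht a + 1 + span q) < m + 1.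
  rewrite blk_lt spanE; move: h; rewrite !intrD intrM; lra.
lia.
Qed.

Let n q a := blk q.*2.+2 (ht a + 1 + span q).

Definition roof q a := anc a (attach q a).

(** From the roof, the branch of level 2q+1 goes half-way down and the branch
    of level 2q leads to the perch at its bottom.  Due to this detour
    through two levels, all points of the lower branch are far away from the roof. *)
Definition midway q c a := hang (roof q a) q.*2.+1 c (attach q a - 2 ^+ q.*2).
Definition perch q c a := hang (midway q c a) q.*2 c (attach q a - span q).

Section Perch.
Variables (q : nat) (a : lpoint) (c : L).
Hypotheses (pa : proper_point base a).
Hypothesis a0 : forall k, (k < q.*2.+2)%N -> lab a k = None.

Let sp : span q = 2 ^+ q.*2 * 2. Proof. by rewrite /span exprS mulrC. Qed.
Let s0 : 0 < 2 ^+ q.*2 :> R. Proof. exact: exp2_gt0. Qed.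

Let ha : ht a <= attach q a.
Proof. by have := attach_gt q a; lra. Qed.

Lemma roof0 k : (k <= q.*2.+1)%N -> lab (roof q a) k = None.
Proof. by move=> kq; rewrite lab_anc // /mask a0 //; case: ifP. Qed.

Lemma proper_roof : proper_point base (roof q a).
Proof. exact: proper_anc. Qed.

Lemma ht_roof : ht (roof q a) = attach q a.
Proof. exact: ht_anc. Qed.

Let hr : ht (roof q a) = (n q a * 2 + 1)%:~R * 2 ^+ q.*2.+1.
Proof. exact: ht_roof. Qed.

Let hm1 : ht (roof q a) - 2 ^+ q.*2.+1 <= attach q a - 2 ^+ q.*2 < ht (roof q a).
Proof. by have := s0; rewrite ht_roof -/(span q) sp => ?; apply/andP; split; lra. Qed.

Let pm : proper_point base (midway q c a).
Proof. exact: proper_hang proper_roof roof0 hr hm1. Qed.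

Let hm : ht (midway q c a) = ((n q a * 2) * 2 + 1)%:~R * 2 ^+ q.*2.
Proof.
by rewrite /= /attach -/(n q a) sp !intrD !intrM; lra.
Qed.

Let hp : ht (midway q c a) - 2 ^+ q.*2 <= attach q a - span q < ht (midway q c a).
Proof. by have := s0; rewrite /= sp => ?; apply/andP; split; lra. Qed.

Let m0 k : (k <= q.*2)%N -> lab (midway q c a) k = None.
Proof. by move=> kq; rewrite /midway lab_hang ltn_eqF // roof0 // leqW. Qed.

Lemma proper_perch : proper_point base (perch q c a).
Proof. exact: proper_hang pm m0 hm hp. Qed.

Lemma anc_perch : anc (perch q c a) (attach q a) = roof q a.
Proof.
have mr : ht (midway q c a) <= attach q a by have := s0; rewrite /=; lra.
rewrite -(anc_anc _ mr) (anc_hang_top c m0 hm hp).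
rewrite /midway -{2}ht_roof.
exact: (anc_hang_top c roof0 hr hm1).
Qed.

Lemma ht_perch : ht (perch q c a) = attach q a - span q.
Proof. by []. Qed.

Lemma lab_perch_high k : (q.*2.+2 <= k)%N -> lab (perch q c a) k = mask a (attach q a) k.
Proof.
move=> qk; rewrite /perch /midway !lab_hang gtn_eqF ?(ltnW qk) // gtn_eqF //.
by rewrite lab_anc.
Qed.

Lemma lab_perch0 : lab (perch q c a) q.*2 = Some c.
Proof. by rewrite /perch lab_hang eqxx. Qed.

Lemma lab_perch1 : lab (perch q c a) q.*2.+1 = Some c.
Proof. by rewrite /perch /midway !lab_hang eqxx gtn_eqF. Qed.

Lemma lab_perch_low k : (k < q.*2)%N -> lab (perch q c a) k = None.
Proof.
move=> kq; rewrite /perch /midway !lab_hang ltn_eqF // ltn_eqF ?roof0 //; first exact/leqW/ltnW.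
exact: leqW.
Qed.

Lemma blk_perch (s : R) : attach q a - span q <= s <= attach q a ->
  blk q.*2.+2 s = n q a.
Proof.
move=> /andP[s1 s2]; apply/blkP; move: s1 s2.
rewrite /attach spanE -/(n q a) !intrD !intrM.
by have := span_ge2 q; move=> *; apply/andP; split; lra.
Qed.

End Perch.
End Attach.

(** * The map to one tree *)

Section Colour.
Context {R : realType} {X : metricType R} (x0 : X).
Variables (U : nat -> set (set X)) (E B eps : nat -> R) (C0 : nat -> set X).

Let base k := C0 k./2.
Local Notation lpoint := (lpoint R (set X)).
Implicit Types (x y : X) (C : set X) (q k d : nat) (G : X -> lpoint).

(** An upper bound for the distance that a point is pushed up to a roof. *)
Definition push q : R := span q * 2 + 2.

(** How far from a point the map of scale q has to be known in order to compute the
    maps of the finer scales at that point. *)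
Definition reach q : R := \sum_(j < q) (B j + 2 * E j).

Lemma reach0 : reach 0 = 0.
Proof. exact: big_ord0. Qed.

Lemma reachS q : reach q.+1 = reach q + (B q + 2 * E q).
Proof. exact: big_ord_recr. Qed.

(** The data for one colour: separated bounded families, one for each scale,
    with one member of each containing a large ball around the base point, and
    the Lipschitz constants that the successive maps will have. *)
Record scales : Prop := Scales {
  scale_gt0 : forall q, 0 < E q ;
  scale_sep : forall q, D_disjoint (2 * E q) (U q) ;
  scale_diam : forall q C, U q C -> forall a b, C a -> C b -> mdist a b <= B q ;
  scale_nonempty : forall q C, U q C -> C !=set0 ;
  scale_base : forall q, U q (C0 q) ;
  scale_ball : forall q x, mdist x0 x <= q%:R + reach q -> C0 q x ;
  scale_eps_gt0 : forall q, 0 < eps q ;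
  scale_eps_step : forall q, eps q.+1 + 2 * (2 * (span q + push q)) / E q <= eps q ;
  scale_eps_diam : forall q, eps q.+1 * (B q + 2 * E q) <= 4^-1 }.

Hypothesis sc : scales.

Local Notation bump q := (bump (E q)).

Lemma bump_uniq q C C' x : U q C -> U q C' ->
  0 < bump q C x -> 0 < bump q C' x -> C = C'.
Proof.
move=> UC UC' h h'; apply: contrapT => ne.
have [y Cy xy] := bump_near (scale_gt0 sc q) h (scale_nonempty sc UC).
have [y' Cy' xy'] := bump_near (scale_gt0 sc q) h' (scale_nonempty sc UC').
have := scale_sep sc UC UC' ne Cy Cy'.
have := metric_triangle y x y'; rewrite (metric_sym y x); lra.
Qed.

Definition centre C := xget x0 C.

Lemma centre_in q C : U q C -> C (centre C).
Proof. by move=> /(scale_nonempty sc)[y Cy]; exact: (@xgetI _ x0 C y). Qed.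

Lemma centre_near q C x : U q C -> 0 < bump q C x -> mdist x (centre C) <= B q + E q.
Proof.
move=> UC h; have [y Cy xy] := bump_near (scale_gt0 sc q) h (scale_nonempty sc UC).
have := scale_diam sc UC Cy (centre_in UC).
have := metric_triangle x y (centre C); lra.
Qed.

Definition member q x := xget set0 [set C | U q C /\ 0 < bump q C x].

Definition step_at q G C x :=
  if bump q C x <= 2^-1
  then anc (G x) (attach q (G (centre C)) - push q * (1 - 2 * bump q C x))
  else anc (perch q C (G (centre C)))
         (attach q (G (centre C)) - span q * (2 * bump q C x - 1)).

(** Near a member C of the cover, the point G x is pushed up to the roof and
    then moved down to the perch of C, as x moves from the rim of the collar
    of C to C itself. *)
Definition step q G x :=
  if `[< exists C, U q C /\ 0 < bump q C x >] then step_at q G (member q x) x else G x.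

Lemma step_in q G C x : U q C -> 0 < bump q C x -> step q G x = step_at q G C x.
Proof.
move=> UC h; rewrite /step; case: asboolP => [_|[]]; last by exists C.
have [Um hm] : [set C | U q C /\ 0 < bump q C x] (member q x).
  by apply: xgetPex; exists C.
by rewrite (bump_uniq Um UC hm h).
Qed.

Lemma step_out q G x : ~ (exists C, U q C /\ 0 < bump q C x) -> step q G x = G x.
Proof. by move=> h; rewrite /step; case: asboolP. Qed.

Definition good q (l : R) G :=
  [/\ forall x, proper_point base (G x), forall x k, (k < q.*2)%N -> lab (G x) k = None
    & forall x y, tdist (G x) (G y) <= l * mdist x y].

Section Step.
Variables (q : nat) (G : X -> lpoint).
Hypothesis gG : good q.+1 (eps q.+1) G.

Let pG x : proper_point base (G x). Proof. by have [] := gG. Qed.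
Let lG x k : (k < q.*2.+2)%N -> lab (G x) k = None.
Proof. by have [_ h _] := gG; exact: h. Qed.

Section At.
Variables (C : set X) (x : X).
Hypotheses (UC : U q C) (hx : 0 < bump q C x).
Let a := G (centre C).

Lemma image_near : tdist (G x) a <= 4^-1.
Proof.
have [_ _ lipG] := gG; apply: le_trans (lipG _ _) _.
apply: le_trans (scale_eps_diam sc q).
have e1 := scale_eps_gt0 sc q.+1; rewrite ler_pM2l //.
have := centre_near UC hx; have := scale_gt0 sc q; lra.
Qed.

Let near_ht : `|ht (G x) - ht a| <= 4^-1.
Proof. exact: le_trans (tdist_ge_ht (pG x) (pG _)) image_near. Qed.

Lemma roof_above : ht (G x) < attach q a.
Proof. by have := near_ht; have := attach_gt q a; rewrite ler_norml => ? /andP[]; lra. Qed.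

Lemma roof_push : attach q a - ht (G x) <= push q.
Proof.
have := near_ht; have := attach_le q a; rewrite ler_norml /push.
by move=> ? /andP[]; lra.
Qed.

(** The images of the points of the collar of C are so close together that their
    ascending lines merge below the roof. *)
Lemma anc_roof : anc (G x) (attach q a) = roof q a.
Proof.
apply: meets_anc; apply: meets_up (meets_meet_ht (pG x) (pG _)) _.
have [h1 h2] := le_meet_ht (pG x) (pG (centre C)).
have := image_near; have := attach_gt q a; rewrite /tdist -/a in h1 h2 *; lra.
Qed.

Lemma bump1 : bump q C x <= 1.
Proof. exact: bump_le1 (scale_gt0 sc q) _ _ (scale_nonempty sc UC). Qed.

Let pp : proper_point base (perch q C a).
Proof. by apply: proper_perch; [exact: pG|move=> k; exact: lG]. Qed.

Lemma tdist_roof_high : bump q C x <= 2^-1 ->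
  tdist (step_at q G C x) (roof q a) <= push q * (1 - 2 * bump q C x).
Proof.
move=> h; rewrite /step_at h -anc_roof -/a.
set s := attach q a - _.
have r1 := roof_above; have r2 := roof_push.
have p0 : 0 <= push q * (1 - 2 * bump q C x).
  by rewrite mulr_ge0 ?/push; have := span_ge2 (R := R) q; lra.
have sa : s <= attach q a by rewrite /s; lra.
have -> : anc (G x) s = anc (G x) (Num.max (ht (G x)) s).
  by rewrite /anc maxA maxxx.
rewrite (tdist_anc (pG x)) ?le_max ?lexx ?(ltW r1) //.
have m1 : Num.max (ht (G x)) s <= attach q a by rewrite ge_max sa ltW.
rewrite ler0_norm ?subr_le0 // opprB lerBlDl.
have : s <= Num.max (ht (G x)) s by rewrite le_max lexx orbT.
rewrite /s; lra.
Qed.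

Lemma tdist_roof_low : 2^-1 < bump q C x ->
  tdist (step_at q G C x) (roof q a) = span q * (2 * bump q C x - 1).
Proof.
have la k : (k < q.*2.+2)%N -> lab a k = None by exact: lG.
move=> h; rewrite /step_at leNgt h /= -/a -(anc_perch C la).
have b1 := bump1; have s2 := span_ge2 (R := R) q.
have m1 : span q * (2 * bump q C x - 1) <= span q by rewrite ler_piMr; lra.
have m0 : 0 <= span q * (2 * bump q C x - 1) by rewrite mulr_ge0; lra.
rewrite (tdist_anc pp) ?ht_perch; [|lra|lra].
by rewrite ler0_norm; lra.
Qed.

Lemma proper_step_at : proper_point base (step_at q G C x).
Proof. by rewrite /step_at; case: ifP => _; exact: proper_anc. Qed.

Lemma tdist_roof : tdist (G x) (roof q a) <= push q.
Proof. by rewrite -anc_roof (tdist_anc1 (pG x)) ?roof_push // ltW ?roof_above. Qed.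

Lemma step_displacement :
  tdist (step_at q G C x) (G x) <= 2 * (span q + push q) * bump q C x.
Proof.
have s2 := span_ge2 (R := R) q; have p2 : 2 <= push q by rewrite /push; lra.
have [h|h] := leP (bump q C x) 2^-1.
  rewrite /step_at h -/a; set s := attach q a - _.
  have [sx|xs] := leP s (ht (G x)).
    by rewrite anc_le // (tdistxx (pG x)) mulr_ge0 ?(ltW hx) //; lra.
  rewrite tdistC (tdist_anc1 (pG x)) ?(ltW xs) //.
  have := roof_push; rewrite /s => r2.
  have : 0 <= span q * bump q C x by apply: mulr_ge0; [lra|exact: ltW].
  by lra.
have t := tdist_triangle proper_step_at (proper_roof q (pG (centre C))) (pG x).
rewrite (tdist_roof_low h) (tdistC (roof q a)) in t.
apply: (le_trans t); have := tdist_roof.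
have : push q <= push q * (2 * bump q C x) by rewrite ler_peMr; lra.
lra.
Qed.

End At.

Lemma step_lip_same C x y : U q C -> 0 < bump q C x -> 0 < bump q C y ->
  tdist (step_at q G C x) (step_at q G C y) <=
  tdist (G x) (G y) + 2 * (span q + push q) * `|bump q C x - bump q C y|.
Proof.
move=> UC.
have s2 := span_ge2 (R := R) q; have p2 : 2 <= push q by rewrite /push; lra.
wlog xy : x y / bump q C x <= bump q C y => [hw hx hy|hx hy].
  have [|/ltW] := leP (bump q C x) (bump q C y) => h; first exact: hw.
  by rewrite tdistC (tdistC (G x)) distrC hw.
have pGx := pG x; have pGy := pG y.
have d0 : 0 <= bump q C y - bump q C x by rewrite subr_ge0.
rewrite (ler0_norm (x := bump q C x - _)) ?subr_le0 // opprB.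
have g0 : 0 <= tdist (G x) (G y) by apply: le_trans (tdist_ge_ht _ _).
have sd0 : 0 <= span q * (bump q C y - bump q C x) by rewrite mulr_ge0 //; lra.
have pd0 : 0 <= push q * (bump q C y - bump q C x) by rewrite mulr_ge0 //; lra.
have [hy2|hy2] := leP (bump q C y) 2^-1.
  rewrite /step_at hy2 (le_trans xy hy2).
  set s := attach q _ - _; set t := attach q _ - _.
  have mm (z : lpoint) (u : R) : anc z u = anc z (Num.max (ht z) u).
    by rewrite /anc maxA maxxx.
  rewrite (mm (G x)) (mm (G y)).
  have m1 : ht (G x) <= Num.max (ht (G x)) s by rewrite le_max lexx.
  have m2 : ht (G y) <= Num.max (ht (G y)) t by rewrite le_max lexx.
  apply: le_trans (tdist_anc_le pGx pGy m1 m2) _.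
  rewrite ge_max; apply/andP; split; first lra.
  apply: le_trans (max_dist_le _ _ _ _) _.
  apply: lerD; first exact: tdist_ge_ht.
  have -> : s - t = - (push q * 2 * (bump q C y - bump q C x)) by rewrite /s /t; ring.
  by rewrite normrN ger0_norm; lra.
have bx1 := bump1 x UC; have by1 := bump1 y UC.
have [hx2|hx2] := leP (bump q C x) 2^-1.
  have t := tdist_triangle (proper_step_at C x)
     (proper_roof q (pG (centre C))) (proper_step_at C y).
  rewrite (tdistC (roof _ _)) (tdist_roof_low UC hy2) in t.
  have := tdist_roof_high UC hx hx2 => h.
  have e1 : push q * (1 - 2 * bump q C x) <= push q * (2 * (bump q C y - bump q C x)).
    by rewrite ler_pM2l; lra.
  have e2 : span q * (2 * bump q C y - 1) <= span q * (2 * (bump q C y - bump q C x)).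
    by rewrite ler_pM2l; lra.
  lra.
rewrite /step_at !leNgt hx2 hy2 /=.
have m z : bump q C z <= 1 -> span q * (2 * bump q C z - 1) <= span q.
  by move=> bz; rewrite ler_piMr; lra.
have mx := m x bx1; have my := m y by1.
have pp : proper_point base (perch q C (G (centre C))).
  by apply: proper_perch; [exact: pG|move=> k; exact: lG].
rewrite (tdist_anc pp) ?ht_perch; [|lra|lra].
rewrite ger0_norm; [lra|].
have : span q * (2 * bump q C x - 1) <= span q * (2 * bump q C y - 1).
  by rewrite ler_pM2l; lra.
lra.
Qed.

(** Inside of one collar the step is Lipschitz because it depends on bump in a
    Lipschitz way.  For points that do not share a collar, at each of them the step
    moves the image by at most a multiple of bump, which is at most a multiple of
    the distance of the two points, as bump vanishes at the other one. *)
Lemma step_good : good q (eps q) (step q G).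
Proof.
have s2 := span_ge2 (R := R) q; have p2 : 2 <= push q by rewrite /push; lra.
have pS x : proper_point base (step q G x).
  rewrite /step; case: asboolP => // _; exact: proper_step_at.
split=> //.
  move=> x k kq; have [[C [UC h]]|h] := pselect (exists C, U q C /\ 0 < bump q C x).
    rewrite (step_in G UC h) /step_at; case: ifP => _; rewrite /anc /= /mask.
      by rewrite lG ?if_same // ltnW // ltnW.
    by rewrite lab_perch_low ?if_same // => l; exact: lG.
  by rewrite step_out // lG // ltnW // ltnW.
move=> x y; have E0 := scale_gt0 sc q.
set c := 2 * (span q + push q); have c0 : 0 <= c by rewrite /c; lra.
have [_ _ lipG] := gG; have lxy := lipG x y.
have dE : 0 <= mdist x y / E q by rewrite divr_ge0 ?mdist_ge0 // ltW.
have goal_le (r : R) : r <= tdist (G x) (G y) + 2 * c * (mdist x y / E q) -> r <= eps q * mdist x y.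
  move=> h; apply: (le_trans h).
  have h2 : (eps q.+1 + 2 * c / E q) * mdist x y <= eps q * mdist x y.
    by apply: ler_wpM2r; [exact: mdist_ge0|exact: scale_eps_step].
  apply: le_trans h2.
  have -> : (eps q.+1 + 2 * c / E q) * mdist x y =
      eps q.+1 * mdist x y + 2 * c * (mdist x y / E q) by ring.
  by rewrite lerD2r.
apply: goal_le.
have cE : 0 <= c * (mdist x y / E q) by exact: mulr_ge0.
have [[C [UC hC]]|nx] := pselect (exists C, U q C /\ 0 < bump q C x); last first.
  have [[C' [UC' hC']]|ny] := pselect (exists C, U q C /\ 0 < bump q C y); last first.
    by rewrite !step_out //; lra.
  rewrite step_out // (step_in G UC' hC').
  have t := tdist_triangle (pG x) (pG y) (proper_step_at C' y).
  have := step_displacement UC' hC'; rewrite tdistC -/c => sd.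
  have := bump_lip E0 y x (scale_nonempty sc UC').
  have -> : bump q C' x = 0.
    apply/eqP; rewrite eq_le bump_ge0 andbT leNgt; apply/negP => h.
    by apply: nx; exists C'.
  rewrite add0r metric_sym => bl.
  have := ler_wpM2l c0 bl; lra.
rewrite (step_in G UC hC).
have [hy|hy] := ltP 0 (bump q C y).
  rewrite (step_in G UC hy); apply: le_trans (step_lip_same UC hC hy) _.
  have := ler_wpM2l c0 (bump_lip_norm E0 x y (scale_nonempty sc UC)).
  rewrite -/c; lra.
have by0 : bump q C y = 0 by apply/eqP; rewrite eq_le hy bump_ge0.
have := bump_lip E0 x y (scale_nonempty sc UC); rewrite by0 add0r => blx.
have := ler_wpM2l c0 blx; have := step_displacement UC hC; rewrite -/c => sdx cbx.
have t := tdist_triangle (proper_step_at C x) (pG x) (pG y).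
have [[C' [UC' hC']]|ny] := pselect (exists C, U q C /\ 0 < bump q C y); last first.
  by rewrite (step_out _ ny); lra.
rewrite (step_in G UC' hC').
have bx0 : bump q C' x = 0.
  apply/eqP; rewrite eq_le bump_ge0 andbT leNgt; apply/negP => h.
  by move: hC'; rewrite (bump_uniq UC' UC h hC) by0 ltxx.
have := bump_lip E0 y x (scale_nonempty sc UC'); rewrite bx0 add0r metric_sym => bly.
have := ler_wpM2l c0 bly; have := step_displacement UC' hC'; rewrite tdistC -/c => sdy cby.
have t' := tdist_triangle (proper_step_at C x) (pG y) (proper_step_at C' y).
lra.
Qed.

End Step.

End Colour.

(** * The tower of maps *)

Section Tower.
Context {R : realType} {X : metricType R} (x0 : X).
Variables (U : nat -> set (set X)) (E B eps : nat -> R) (C0 : nat -> set X).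
Hypothesis sc : scales x0 U E B eps C0.

Let base k := C0 k./2.
Local Notation lpoint := (lpoint R (set X)).
Local Notation bump q := (bump (E q)).
Local Notation step := (step x0 U E).
Local Notation reach := (reach E B).
Implicit Types (x y : X) (C : set X) (p q k d : nat).

(** The map to the stratum 2q that is built from the scales q, ..., q + d - 1,
    starting with a constant map at scale q + d. *)
Fixpoint tower d q : X -> lpoint :=
  if d is d'.+1 then step q (tower d' q.+1) else fun=> root_point base q.*2.

Lemma towerS d q x : tower d.+1 q x = step q (tower d q.+1) x.
Proof. by []. Qed.

Lemma tower_good d q : good C0 q (eps q) (tower d q).
Proof.
elim: d q => [|d IH] q /=; last exact: (step_good sc (IH q.+1)).
have pr : proper_point base (root_point base q.*2 : lpoint) by exact: proper_root.
split=> [_|_ k kq|x y]; first exact: proper_root.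
  by rewrite /= kq.
rewrite (tdistxx pr) mulr_ge0 ?mdist_ge0 //.
exact: ltW (scale_eps_gt0 sc q).
Qed.

Lemma tower_proper d q x : proper_point base (tower d q x).
Proof. by have [] := tower_good d q. Qed.

Lemma tower_low d q x k : (k < q.*2)%N -> lab (tower d q x) k = None.
Proof. by have [_ h _] := tower_good d q; exact: h. Qed.

(** The base member of scale q + d contains a large ball, on which one step from
    the constant map therefore gives the constant map of the next finer scale.
    Each further step looks at points at distance at most B q + E q. *)
Lemma tower_stable d q x : mdist x0 x <= (q + d)%:R + reach q ->
  tower d.+1 q x = tower d q x.
Proof.
elim: d q x => [|d IH] q x hx.
  rewrite addn0 in hx; have Cx := scale_ball sc hx.
  have b1 : bump q (C0 q) x = 1 by exact: bump_in.
  have UC := scale_base sc q.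
  have h1 : 0 < bump q (C0 q) x by rewrite b1.
  rewrite towerS (step_in sc _ UC h1) /step_at b1 /=.
  have -> : ((1 : R) <= 2^-1) = false by apply/negbTE; rewrite -ltNge; lra.
  set a := root_point base q.+1.*2.
  have s2 := span_ge2 (R := R) q.
  have n0 : blk q.*2.+2 (ht a + 1 + span q) = 0.
    by apply/blkP; rewrite spanE mul0r /=; apply/andP; split; lra.
  have aE : attach q a = span q by rewrite /attach n0 mul0r add0r mul1r.
  rewrite aE anc_le; last by rewrite /= aE; lra.
  apply: pointP => [|k]; first by rewrite /= aE subrr.
  have la k' : (k' < q.*2.+2)%N -> lab a k' = None by move=> kq; rewrite /= doubleS kq.
  have [kq|qk] := ltnP k q.*2; first by rewrite lab_perch_low // /= kq.
  rewrite [RHS]/= ltnNge qk [RHS]/=.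
  have [->|k0] := eqVneq k q.*2; first by rewrite lab_perch0 /base doubleK.
  have [->|k1] := eqVneq k q.*2.+1.
    by rewrite lab_perch1 /base /= uphalf_double.
  have qk2 : (q.*2.+2 <= k)%N by lia.
  rewrite lab_perch_high // aE /mask /= ltnNge doubleS qk2 /= blk_zero.
  have -> : blk k (span q : R) = 0; last by rewrite eqxx.
  rewrite -(blk_zero (R := R) k); apply: eq_blk qk2 _; rewrite blk_zero.
  by apply/blkP; rewrite spanE mul0r add0r /=; apply/andP; split; lra.
have st y : mdist x0 y <= mdist x0 x + (B q + E q) ->
    tower d.+1 q.+1 y = tower d q.+1 y.
  move=> hy; apply: IH; rewrite reachS addSnnS.
  by have := scale_gt0 sc q; lra.
have BE : 0 <= B q + E q.
  have UC := scale_base sc q; have [c Cc] := scale_nonempty sc UC.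
  have := scale_diam sc UC Cc Cc; rewrite mdistxx; have := scale_gt0 sc q; lra.
have stx : tower d.+1 q.+1 x = tower d q.+1 x by apply: st; lra.
have [[C [UC h]]|h] := pselect (exists C, U q C /\ 0 < bump q C x); last first.
  by rewrite !towerS !(step_out _ _ h).
rewrite 2!towerS 2!(step_in sc _ UC h) /step_at.
rewrite stx st //; have := centre_near sc UC h.
have := metric_triangle x0 x (centre x0 C); lra.
Qed.

Lemma tower_stable0 d d' x : mdist x0 x <= d%:R -> (d <= d')%N ->
  tower d' 0 x = tower d 0 x.
Proof.
move=> hx; elim: d' => [|d' IH]; first by rewrite leqn0 => /eqP->.
rewrite leq_eqVlt => /orP[/eqP->//|]; rewrite ltnS => dd.
rewrite -IH //; apply: tower_stable.
by rewrite reach0 addr0 add0n (le_trans hx) // ler_nat.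
Qed.

(** A label other than those of the constant map is put on by a step inside of the
    collar of that label. *)
Lemma tower_labels d q x k c : (k < (q + d).*2)%N -> lab (tower d q x) k = Some c ->
  U k./2 c /\ 0 < bump k./2 c x.
Proof.
elim: d q => [|d IH] q; first by rewrite addn0 => kq; rewrite /= kq.
rewrite addnS -addSn => kd.
have old : forall z : lpoint, (exists u, z = anc (tower d q.+1 x) u) ->
    lab z k = Some c -> U k./2 c /\ 0 < bump k./2 c x.
  by move=> _ [u ->]; rewrite /anc /= /mask; case: ifP => // _; exact: IH kd.
have gG := tower_good d q.+1.
have [[C [UC h]]|h] := pselect (exists C, U q C /\ 0 < bump q C x); last first.
  by rewrite towerS (step_out _ _ h) //; exact: IH kd.
rewrite towerS (step_in sc _ UC h) /step_at; case: ifP => _.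
  by apply: old; eexists.
set a := tower d q.+1 (centre x0 C).
have la k' : (k' < q.*2.+2)%N -> lab a k' = None by exact: (@tower_low d q.+1).
rewrite /= /mask; case: ifP => // _; rewrite -/(perch q C a).
have [kq|qk] := ltnP k q.*2; first by rewrite lab_perch_low.
have [->|k0] := eqVneq k q.*2.
  by rewrite lab_perch0 doubleK => -[<-].
have [->|k1] := eqVneq k q.*2.+1.
  by rewrite lab_perch1 /= uphalf_double => -[<-].
rewrite lab_perch_high; last by lia.
have ha : ht a <= attach q a by have := attach_gt q a; lra.
rewrite -(lab_anc ha) -/(roof q a) -(anc_roof sc gG UC h).
by apply: old; eexists.
Qed.

(** A point x of a member C of the q-th cover is mapped to the perch of C.  The
    maps of the finer scales p push it up, but never above the end e of its
    branch of level 2q, because e - 2 ^ (2p + 1) is one of the heights at which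
    roofs of scale p are. *)
Definition under p q C (z : lpoint) :=
  [/\ lab z q.*2 = Some C, lab z q.*2.+1 = Some C
    & ht z + 2 ^+ p.*2 <= (blk q.*2 (ht z) + 1)%:~R * 2 ^+ q.*2].

Lemma tower_under_top d q C x : U q C -> C x -> under q q C (tower d.+1 q x).
Proof.
move=> UC Cx; have b1 : bump q C x = 1 by exact: bump_in.
have h1 : 0 < bump q C x by rewrite b1.
rewrite towerS (step_in sc _ UC h1) /step_at b1 /=.
have -> : ((1 : R) <= 2^-1) = false by apply/negbTE; rewrite -ltNge; lra.
set a := tower d q.+1 (centre x0 C).
rewrite anc_le; last by rewrite ht_perch; lra.
split; [exact: lab_perch0|exact: lab_perch1|].
rewrite ht_perch.
have -> : attach q a - span q = (blk q.*2.+2 (ht a + 1 + span q) * 4)%:~R * 2 ^+ q.*2.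
  rewrite /attach; have -> : (span q : R) = 2 ^+ q.*2 * 2 by rewrite /span exprS mulrC.
  by rewrite !intrD !intrM; ring.
by rewrite blk_mul intrD mulrDl mul1r.
Qed.

Lemma tower_under d p q C x : (p <= q)%N -> U q C -> C x ->
  under p q C (tower (d.+1 + (q - p)) p x).
Proof.
move=> pq UC Cx; move eqm : (q - p)%N => m.
elim: m p pq eqm => [|m IH] p pq eqm.
  have -> : p = q by lia.
  by rewrite addn0; exact: tower_under_top.
have pq1 : (p < q)%N by lia.
have [l0 l1 hz] := IH p.+1 pq1 ltac:(lia).
rewrite addnS; move: (d.+1 + m)%N l0 l1 hz => N l0 l1 hz.
have gG := tower_good N p.+1.
set t := ht (tower N p.+1 x) in hz *.
pose e : R := (blk q.*2 t + 1)%:~R * 2 ^+ q.*2.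
have s2 := span_ge2 (R := R) p.
have sE : 2 ^+ p.+1.*2 = 2 * span p :> R by exact: spanE.
have s1 : 2 ^+ p.*2 <= span p :> R by rewrite /span exprS; have := exp2_gt0 (R := R) p.*2; lra.
have [[C' [UC' h]]|h] := pselect (exists C, U p C /\ 0 < bump p C x); last first.
  rewrite towerS (step_out _ _ h) //; split=> //.
  by rewrite -/t; move: hz; rewrite sE; lra.
set a := tower N p.+1 (centre x0 C').
have ta : ht a <= t + 4^-1.
  have := image_near sc gG UC' h; have := tdist_ge_ht (tower_proper N p.+1 x) (tower_proper N p.+1 (centre x0 C')).
  by rewrite -/a -/t ler_norml => /andP[]; lra.
have dq : (p.*2.+2 <= q.*2)%N by lia.
have He : attach p a <= e - span p.
  have [m' em] : exists m' : int, e - span p = (m' * 2 + 1)%:~R * span p.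
    exists ((blk q.*2 t + 1) * 2 ^+ (q.*2 - p.*2.+2) - 1).
    rewrite /e (dyadicM _ dq) spanE; move: (_ * 2 ^+ _) => M.
    by rewrite intrD intrM rmorphB /=; ring.
  by rewrite em; apply: attach_min; rewrite -em; move: hz; rewrite sE -/e; lra.
have tH : t < attach p a by have := roof_above sc gG UC' h.
have be (s : R) : t <= s -> s < e -> blk q.*2 s = blk q.*2 t.
  move=> ts se; apply/blkP; rewrite se andbT (le_trans _ ts) //.
  by have /andP[] := blk_itv q.*2 t.
rewrite towerS (step_in sc _ UC' h) /step_at -/a; case: ifP => b2.
  set s := attach p a - _; set z := anc _ s.
  have hz' : ht z = Num.max t s by [].
  have sa : s <= attach p a.
    have : 0 <= push p * (1 - 2 * bump p C' x) :> R.
      have p0 : 0 <= push p :> R by rewrite /push; lra.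
      by apply: mulr_ge0 => //; lra.
    by rewrite /s; lra.
  have ze : ht z <= e - span p by rewrite hz' ge_max; apply/andP; split; lra.
  have tz : t <= ht z by rewrite hz' le_max lexx.
  have bz : blk q.*2 (ht z) = blk q.*2 t by apply: be; lra.
  split; last by rewrite bz -/e; lra.
    by rewrite /z /= -/t -hz' (mask_block (leqnn _)).
  by rewrite /z /= -/t -hz' (mask_block (leqnSn _)).
have la k' : (k' < p.*2.+2)%N -> lab a k' = None by exact: (@tower_low N p.+1).
have b1 := bump1 sc x UC'.
set s := attach p a - _; set z := anc _ s.
have hs : attach p a - span p <= s <= attach p a.
  have : span p * (2 * bump p C' x - 1) <= span p :> R by rewrite ler_piMr //; lra.
  have : 0 <= span p * (2 * bump p C' x - 1) :> R.
    by apply: mulr_ge0; [lra|move/negbT: b2; rewrite -ltNge; lra].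
  by rewrite /s => *; apply/andP; split; lra.
have hz' : ht z = s by rewrite ht_anc // ht_perch; case/andP: hs.
have bH : blk q.*2 (attach p a) = blk q.*2 t by apply: be; [exact: ltW|lra].
have hH : attach p a - span p <= attach p a <= attach p a by rewrite lexx andbT; lra.
have hP : attach p a - span p <= attach p a - span p <= attach p a by rewrite lexx; lra.
have bs : blk q.*2 s = blk q.*2 t.
  by rewrite -bH; apply: eq_blk dq _; rewrite (blk_perch hs) (blk_perch hH).
have bp : blk q.*2 (attach p a - span p) = blk q.*2 t.
  by rewrite -bH; apply: eq_blk dq _; rewrite (blk_perch hP) (blk_perch hH).
have ha : ht a <= attach p a by have := attach_gt p a; lra.
have lz k : (q.*2 <= k)%N -> lab z k = lab (tower N p.+1 x) k.
  move=> qk; rewrite lab_anc; last by rewrite ht_perch; case/andP: hs.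
  rewrite (mask_block qk); last by rewrite ht_perch bp.
  rewrite lab_perch_high; last exact: leq_trans qk.
  rewrite -(lab_anc ha) -/(roof p a) -(anc_roof sc gG UC' h) lab_anc ?(ltW tH) //.
  by rewrite (mask_block qk).
split; [by rewrite lz|by rewrite lz|].
by rewrite hz' bs -/e; case/andP: hs; lra.
Qed.

(** The number of scales after which the tower is stable at x. *)
Definition depth x := Num.bound (mdist x0 x).
Definition limit_point x := tower (depth x) 0 x.

Lemma limit_pointE d x : (depth x <= d)%N -> limit_point x = tower d 0 x.
Proof.
move=> xd; apply/esym/tower_stable0 => //.
exact/ltW/archi_boundP/mdist_ge0.
Qed.

Lemma limit_proper x : proper_point base (limit_point x).
Proof. exact: tower_proper. Qed.

Lemma limit_lip x y : tdist (limit_point x) (limit_point y) <= eps 0 * mdist x y.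
Proof.
rewrite (limit_pointE (leq_maxl (depth x) (depth y))).
rewrite (limit_pointE (leq_maxr (depth x) (depth y))).
by have [_ _ h] := tower_good (maxn (depth x) (depth y)) 0; exact: h.
Qed.

Lemma limit_labels x k c : lab (limit_point x) k = Some c ->
  U k./2 c /\ 0 < bump k./2 c x.
Proof.
rewrite (limit_pointE (leq_maxl (depth x) k.+1)); apply: tower_labels.
by rewrite add0n; lia.
Qed.

Lemma limit_under q C x : U q C -> C x -> under 0 q C (limit_point x).
Proof.
move=> UC Cx; rewrite (@limit_pointE ((depth x).+1 + (q - 0))); last by lia.
exact: tower_under.
Qed.

(** Points of C are far below the roof of C, whereas points outside of the
    collar of C are not below it at all. *)
Lemma limit_far q C x y : U q C -> C x -> ~ 0 < bump q C y ->
  2 ^+ q.*2 <= tdist (limit_point x) (limit_point y).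
Proof.
move=> UC Cx ny; have [l0 l1 _] := limit_under UC Cx.
have px := limit_proper x; have py := limit_proper y.
have [xm ym em] := meets_meet_ht px py.
have [_ xd _] := px; have d0 : digit0 q.*2 (ht (limit_point x)) by apply: xd; rewrite l0.
have gap := digit0_gap d0.
suff : (blk q.*2.+1 (ht (limit_point x)) + 1)%:~R * 2 ^+ q.*2.+1 <=
    meet_ht (limit_point x) (limit_point y) by rewrite /tdist; lra.
rewrite -blk_ge lezD1 lt_neqAle le_blk // andbT; apply/eqP => e.
have := em q.*2.+1; rewrite {1}/mask -e eqxx l1 /mask; case: eqP => // _ /esym ly.
by apply: ny; have [_] := limit_labels ly; rewrite /= uphalf_double.
Qed.

End Tower.

(** * Proper spaces and local finiteness *)

(** Otherwise the cofinite filter of Z has a cluster point; but a small ball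
    around it contains at most one point of Z. *)
Lemma separated_finite {R : realType} {X : metricType R} (K Z : set X) (d : R) :
  compact K -> Z `<=` K -> 0 < d ->
  (forall z z', Z z -> Z z' -> z <> z' -> d <= mdist z z') -> finite_set Z.
Proof.
move=> cK ZK d0 sep; apply: contrapT => infZ.
pose F : set_system X := [set A | finite_set (Z `\` A)].
have FF : ProperFilter F.
  split; first by rewrite /F /= setD0.
  split.
  - by rewrite /F /= setDT; exact: finite_set0.
  - by move=> P Q; rewrite /F /= setDIr finite_setU.
  - move=> P Q PQ; rewrite /F /=; apply: sub_finite_set.
    by move=> z [Zz nQ]; split=> // /PQ.
have FK : F K by rewrite /F /= (_ : Z `\` K = set0) ?setD_eq0.
have [p [_ clp]] := cK F FF FK.
pose z0 := xget p (Z `&` ball p (d / 2)).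
have FA : F (Z `\ z0).
  rewrite /F /=; apply: (@sub_finite_set _ _ [set z0]); last exact: finite_set1.
  by move=> z [Zz nz]; apply: contrapT => zz; apply: nz.
have d2 : 0 < d / 2 by rewrite divr_gt0.
have [z [[Zz nz] pz]] := clp _ _ FA (nbhsx_ballx p _ d2).
have [Z0 p0] : (Z `&` ball p (d / 2)) z0 by apply: xgetPex; exists z.
have := sep _ _ Zz Z0 nz; move: pz p0; rewrite !ballEmdist /=.
have := metric_triangle z p z0; rewrite (metric_sym z p); lra.
Qed.

(** Choosing one point of K in every member gives a separated subset of K. *)
Lemma separated_family_finite {R : realType} {X : metricType R} (K : set X)
    (V : set (set X)) (d : R) :
  compact K -> 0 < d -> D_disjoint d V ->
  (forall C, V C -> (C `&` K) !=set0) -> finite_set V.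
Proof.
move=> cK d0 sep VK.
have [->|[C1 VC1]] : V = set0 \/ V !=set0.
  by have [->|/set0P] := eqVneq V set0; [left|right].
  exact: finite_set0.
have [x1 _] := VK _ VC1.
pose pt C := xget x1 (C `&` K).
have ptP C : V C -> (C `&` K) (pt C) by move=> /VK h; exact: xgetPex.
pose own z := xget set0 [set C | V C /\ C z].
have ownP C : V C -> own (pt C) = C.
  move=> VC; have [Cp _] := ptP C VC.
  have [VO Op] : [set C | V C /\ C (pt C)] C by split.
  have [Vo Cz] : [set C' | V C' /\ C' (pt C)] (own (pt C)) by apply: xgetPex; exists C.
  apply: contrapT => ne; have := sep _ _ Vo VC ne _ _ Cz Cp.
  by rewrite mdistxx; lra.
apply: (@sub_finite_set _ _ (own @` (pt @` V))).
  by move=> C VC; exists (pt C); [exists C|exact: ownP].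
apply: finite_image; apply: (separated_finite cK _ d0).
  by move=> _ [C VC <-]; have [] := ptP C VC.
move=> _ _ [C VC <-] [C' VC' <-] ne.
have [Cp _] := ptP C VC; have [Cp' _] := ptP C' VC'.
by apply: (sep C C') => // e; apply: ne; rewrite e.
Qed.

(** * The tree of one colour *)

Section ColourTree.
Context {R : realType} {X : metricType R} (x0 : X).
Variables (U : nat -> set (set X)) (E B eps : nat -> R) (C0 : nat -> set X).
Hypothesis proper : proper_space X.
Hypothesis sc : scales x0 U E B eps C0.

Let base k := C0 k./2.
Local Notation bump q := (bump (E q)).

(** A branch labelled c may hang below one labelled c' when the collars of c and
    c' meet; this is what keeps the tree locally finite. *)
Definition adjacent k c j c' := c = base k \/
  [/\ U k./2 c, U j./2 c' & exists x, 0 < bump k./2 c x /\ 0 < bump j./2 c' x].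

Lemma adjacent_base k j c : adjacent k (base k) j c.
Proof. by left. Qed.

Lemma adjacent_finite k j c : finite_set [set c' | adjacent k c' j c].
Proof.
set q := k./2; set p := j./2.
have [Uc|nU] := pselect (U p c); last first.
  apply: (@sub_finite_set _ _ [set base k]); last exact: finite_set1.
  by move=> c' [->|[]].
have [y0 cy0] := scale_nonempty sc Uc.
pose K := [set y | mdist y0 y <= B p + E p + E q].
pose V := U q `&` [set C | (C `&` K) !=set0].
apply: (@sub_finite_set _ _ ([set base k] `|` V)).
  move=> c' [->|[Uc' _ [x [h h']]]]; first by left.
  right; split=> //=.
  have [y c'y xy] := bump_near (scale_gt0 sc q) h (scale_nonempty sc Uc').
  have [z cz xz] := bump_near (scale_gt0 sc p) h' (scale_nonempty sc Uc).
  exists y; split=> //; rewrite /K /=.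
  have := scale_diam sc Uc cy0 cz; have := metric_triangle y0 z y.
  have := metric_triangle z x y; rewrite (metric_sym z x); lra.
rewrite finite_setU; split; first exact: finite_set1.
apply: (@separated_family_finite _ _ K V (2 * E q)); first exact: proper.
- by rewrite mulr_gt0 // (scale_gt0 sc).
- by move=> C C' [UC _] [UC' _]; exact: (scale_sep sc UC UC').
- by move=> C [].
Qed.

Definition colour_labels : label_system :=
  @LabelSystem (set X) base adjacent adjacent_base adjacent_finite.

Lemma limit_compatible x :
  compatible (D := colour_labels) (limit_point x0 U E C0 x : lpoint R (lbl colour_labels)).
Proof.
move=> k j c c' _ /(limit_labels sc)[Uc h] /(limit_labels sc)[Uc' h'].
by right; split=> //; exists x.
Qed.

Definition colour_map x : @tree R colour_labels :=
  @Tree R colour_labels _ (limit_proper sc x) (@limit_compatible x).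

End ColourTree.

(** * Choosing the covers *)

Section Covers.
Context {R : realType} {X : metricType R} (x0 : X) (n : nat).
Hypothesis asdimX : asdim_le X n.
Implicit Types (e b r : R) (q : nat).

(** The data of scale q for all colours, given the Lipschitz constant l that is
    prescribed for this scale and the sum r of the earlier sizes. *)
Record one_scale q (l r e b : R) (U : 'I_n.+1 -> set (set X)) (C0 : 'I_n.+1 -> set X) : Prop :=
  OneScale {
  one_gt0 : 0 < e ;
  one_step : 2 * (2 * (span q + push q)) / e <= l / 2 ;
  one_size : 0 < b + 2 * e ;
  one_sep : forall i, D_disjoint (2 * e) (U i) ;
  one_diam : forall i C, U i C -> forall x y, C x -> C y -> mdist x y <= b ;
  one_nonempty : forall i C, U i C -> C !=set0 ;
  one_base : forall i, U i (C0 i) ;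
  one_ball : forall i x, mdist x0 x <= q%:R + r -> C0 i x ;
  one_cover : forall x, exists i C, U i C /\ C x }.

(** In every colour, the large ball swallows the members of the cover that come
    close to it. *)
Lemma one_scale_ex q (l r : R) : 0 < l -> 0 <= r ->
  exists t : R * R * ('I_n.+1 -> set (set X)) * ('I_n.+1 -> set X),
    one_scale q l r t.1.1.1 t.1.1.2 t.1.2 t.2.
Proof.
move=> l0 r0.
have s2 := span_ge2 (R := R) q; have p2 : 2 <= push q :> R by rewrite /push; lra.
pose e := 8 * (span q + push q) / l.
have e0 : 0 < e by rewrite /e divr_gt0 //; lra.
have e2 : 0 < 2 * e by lra.
have [V [[b0 hb] cov sep]] := asdimX e2.
pose b := Num.max 0 b0.
have bge : 0 <= b by rewrite le_max lexx.
have bV i S : V i S -> forall x y, S x -> S y -> mdist x y <= b.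
  move=> VS x y Sx Sy; apply: le_trans (hb S _ x y Sx Sy) _; first by exists i.
  by rewrite le_max lexx orbT.
pose Q := [set x | mdist x0 x <= q%:R + r].
have q0 : 0 <= q%:R :> R by [].
have Q0 : Q x0 by rewrite /Q /= mdistxx addr_ge0.
pose far i := [set S | [/\ V i S, S !=set0 & forall a v, Q a -> S v -> 2 * e <= mdist a v]].
pose C0 i := Q `|` \bigcup_(S in V i `\` far i) S.
exists (e, 2 * (q%:R + r + 2 * e + b), fun i => C0 i |` far i, C0) => /=.
have C0near i x : C0 i x -> mdist x0 x <= q%:R + r + 2 * e + b.
  move=> [Qx|[S [VS nS] Sx]]; first by move: Qx; rewrite /Q /=; lra.
  have [a [v [Qa Sv av]]] : exists a v, [/\ Q a, S v & mdist a v < 2 * e].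
    apply: contrapT => H; apply: nS; split=> //; first by exists x.
    move=> a v Qa Sv; rewrite leNgt; apply/negP => av; apply: H.
    by exists a, v.
  have := bV i S VS v x Sv Sx; have := metric_triangle x0 a x.
  have := metric_triangle a v x; move: Qa; rewrite /Q /=; lra.
have C0far i S : far i S -> forall x y, C0 i x -> S y -> 2 * e <= mdist x y.
  move=> [VS _ hS] x y [Qx|[S' [VS' nS'] S'x]] Sy; first exact: hS.
  apply: (sep i S' S) => // e1; apply: nS'; rewrite e1; split=> //.
  by exists y.
split=> //.
- rewrite /e; have -> : 2 * (2 * (span q + push q)) / (8 * (span q + push q) / l) = l / 2.
    by field; apply/andP; split; rewrite ?gt_eqF //; lra.
  exact: lexx.
- lra.
- move=> i C C' [->|fC] [->|fC'] ne x y Cx Cy //.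
  + exact: (C0far i C').
  + by rewrite metric_sym; exact: (C0far i C).
  + by case: fC => VC _ _; case: fC' => VC' _ _; exact: (sep i C C').
- move=> i C [->|[VC _ _]] x y Cx Cy.
    have := C0near i x Cx; have := C0near i y Cy.
    by have := metric_triangle x x0 y; rewrite (metric_sym x x0); lra.
  by have := bV i C VC x y Cx Cy; lra.
- by move=> i C [->|[]//]; exists x0; left.
- by move=> i; left.
- by move=> i x hx; left.
- move=> x; have : setT x by [].
  rewrite -cov => -[S [i _ VS] Sx].
  have [fS|nS] := pselect (far i S); first by exists i, S; split=> //; right.
  by exists i, (C0 i); split; [left|right; exists S].
Qed.

(** The width of the collars of a scale is chosen after the Lipschitz constant for
    that scale, and the Lipschitz constant for the next scale after the size of the
    cover that the asymptotic dimension provides for this width. *)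
Lemma scales_ex : exists (U : 'I_n.+1 -> nat -> set (set X)) (E B eps : nat -> R)
    (C0 : 'I_n.+1 -> nat -> set X),
  [/\ eps 0 = 1, forall i, scales x0 (U i) E B eps (C0 i)
    & forall q x, exists i C, U i q C /\ C x].
Proof.
pose data := (R * R * ('I_n.+1 -> set (set X)) * ('I_n.+1 -> set X))%type.
have [g hg] : exists g : nat -> R * R -> data, forall q s, 0 < s.1 -> 0 <= s.2 ->
    one_scale q s.1 s.2 (g q s).1.1.1 (g q s).1.1.2 (g q s).1.2 (g q s).2.
  have h (a : nat * (R * R)) : exists t : data, 0 < a.2.1 -> 0 <= a.2.2 ->
      one_scale a.1 a.2.1 a.2.2 t.1.1.1 t.1.1.2 t.1.2 t.2.
    have [l0|nl] := pselect (0 < a.2.1); last first.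
      by exists (0, 0, fun=> set0, fun=> set0).
    have [r0|nr] := pselect (0 <= a.2.2); last first.
      by exists (0, 0, fun=> set0, fun=> set0).
    by have [t ht] := one_scale_ex a.1 l0 r0; exists t.
  by have [g hg] := choice h; exists (fun q s => g (q, s)) => q s; exact: hg (q, s).
pose next q (s : R * R) : R * R :=
  let t := g q s in
  (Num.min (s.1 / 2) (4^-1 / (t.1.1.2 + 2 * t.1.1.1)), s.2 + (t.1.1.2 + 2 * t.1.1.1)).
pose st := fix st q := if q is q'.+1 then next q' (st q') else (1, 0).
have st_ok q : 0 < (st q).1 /\ 0 <= (st q).2.
  elim: q => [|q [l0 r0]] /=; first by rewrite ltr01.
  have h := one_size (hg q _ l0 r0).
  by split; [rewrite lt_min !divr_gt0|apply: addr_ge0 => //; exact: ltW].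
pose t q := g q (st q).
have ht q : one_scale q (st q).1 (st q).2 (t q).1.1.1 (t q).1.1.2 (t q).1.2 (t q).2.
  by have [l0 r0] := st_ok q; exact: hg.
exists (fun i q => (t q).1.2 i), (fun q => (t q).1.1.1), (fun q => (t q).1.1.2),
  (fun q => (st q).1), (fun i q => (t q).2 i); split=> //; last first.
  by move=> q x; exact: (one_cover (ht q)).
have rE q : (st q).2 = reach (fun q => (t q).1.1.1) (fun q => (t q).1.1.2) q.
  elim: q => [|q IH]; first by rewrite reach0.
  by rewrite reachS -IH.
move=> i; split.
- by move=> q; exact: (one_gt0 (ht q)).
- by move=> q; exact: (one_sep (ht q)).
- by move=> q; exact: (one_diam (ht q)).
- by move=> q; exact: (one_nonempty (ht q)).
- by move=> q; exact: (one_base (ht q)).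
- by move=> q x; rewrite -rE; exact: (one_ball (ht q)).
- by move=> q; have [] := st_ok q.
- move=> q; have h1 := one_step (ht q).
  have : (st q.+1).1 <= (st q).1 / 2 by rewrite /= ge_min lexx.
  lra.
- move=> q; have h1 := one_size (ht q).
  by rewrite -ler_pdivlMr // /= ge_min lexx orbT.
Qed.

End Covers.

(** * Control functions *)

Section Control.
Context {R : realType}.

Lemma id_control : large_scale_control (id : R -> R).
Proof. by split=> //; exact: cvg_id. Qed.

(** If far away points have far away images, a control function is obtained as
    the infimum of the distances of the images; the value t is added to
    the set because a bounded space has no points at distance at least t. *)
Lemma lower_control_ex {X : Type} (d1 d2 : X -> X -> R) :
  (forall x y, 0 <= d2 x y) ->
  (forall M : R, exists t, forall x y, t <= d1 x y -> M <= d2 x y) ->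
  exists phi, large_scale_control phi /\ forall x y, 0 <= d1 x y -> phi (d1 x y) <= d2 x y.
Proof.
move=> d0 far.
pose S t := [set s | exists x y, t <= d1 x y /\ s = d2 x y] `|` [set t].
have lb t s : 0 <= t -> S t s -> 0 <= s by move=> t0 [[x [y [_ ->]]]|->].
have nS t : S t !=set0 by exists t; right.
have hlb t : 0 <= t -> has_lbound (S t) by move=> t0; exists 0 => s; exact: lb.
exists (fun t => inf (S t)); split; last first.
  by move=> x y xy0; apply: ge_inf; [exact: hlb|left; exists x, y].
split.
- by move=> t t0; apply: lb_le_inf => // s; exact: lb.
- move=> s t; rewrite !in_itv /= !andbT => s0 t0 st.
  apply: lb_le_inf => // u [[x [y [tx ->]]]|->].
    by apply: ge_inf; [exact: hlb|left; exists x, y; rewrite (le_trans st)].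
  by apply: le_trans st; apply: ge_inf; [exact: hlb|right].
- apply/cvgryPge => M; have [t ht] := far M; near=> u.
  have tu : t <= u by near: u; apply: nbhs_pinfty_ge; exact: num_real.
  have Mu : M <= u by near: u; apply: nbhs_pinfty_ge; exact: num_real.
  by apply: lb_le_inf => // s [[x [y [uy ->]]]|->//]; apply: ht; exact: le_trans uy.
Unshelve. all: by end_near. Qed.

End Control.

(** * The embedding *)

Section Main.
Context {R : realType} (n : nat) (X : metricType R).

Definition embeds_in_trees : Prop :=
  exists (T : 'I_n.+1 -> metricType R) (F : forall i, nat -> set (T i)),
    [/\ forall i, locally_finite_tree (T i),
        forall i, binary_regular_filtration (F i)
      & exists f : X -> (forall i, T i),
          (forall x, M_space F (f x)) /\
          large_scale_embedding (@mdist R X) (@sup_dist R n T) f].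

Lemma unit_finite (A : set unit) : finite_set A.
Proof. by []. Qed.

Definition unit_labels : label_system :=
  @LabelSystem unit (fun=> tt) (fun _ _ _ _ => True)
    (fun _ _ _ => I) (fun _ _ _ => unit_finite _).

Lemma empty_embeds : (X -> False) -> embeds_in_trees.
Proof.
move=> X0; exists (fun=> @tree R unit_labels), (fun=> @stratum R unit_labels); split.
- by move=> i; exact: tree_locally_finite.
- by move=> i; exact: stratum_binary_regular.
- exists (fun x => match X0 x with end); split; first by move=> x; case: (X0 x).
  by exists id, id; split; [exact: id_control|exact: id_control|move=> x; case: (X0 x)].
Qed.

Lemma pointed_embeds (x0 : X) : proper_space X -> asdim_le X n -> embeds_in_trees.
Proof.
move=> pX aX; have [U [E [B [eps [C0 [eps1 sc cov]]]]]] := scales_ex x0 aX.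
pose D i := colour_labels pX (sc i).
exists (fun i => @tree R (D i)), (fun i => @stratum R (D i)); split.
- by move=> i; exact: tree_locally_finite.
- by move=> i; exact: stratum_binary_regular.
pose f (x : X) i : @tree R (D i) := colour_map pX (sc i) x.
exists f; split.
  move=> x; apply: tree_M_space => k; have [i [C [UC Cx]]] := cov k./2 x.
  exists i; have [l0 l1 _] := limit_under (sc i) UC Cx.
  rewrite /=; have := odd_double_half k; case: (odd k) => /= <-.
    by rewrite add1n l1.
  by rewrite add0n l0.
have d2_0 x y : 0 <= sup_dist (f x) (f y) by exact: bigmax_ge_id.
have [|phi [cphi hphi]] := @lower_control_ex R X (@mdist R X) (fun x y => sup_dist (f x) (f y)) d2_0.
  (* x lies in a member of the cover of scale q in some colour i, and y is too far
     from x to lie in its collar *)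
  move=> M; pose q := Num.bound (Num.max 0 M).
  exists (B q + 2 * E q) => x y dxy.
  have [i [C [UC Cx]]] := cov q x.
  have h : 2 ^+ q.*2 <= mdist (f x i) (f y i).
    apply: (limit_far (sc i) UC Cx) => h.
    have E0 := scale_gt0 (sc i) q.
    have [c Cc yc] := bump_near E0 h (scale_nonempty (sc i) UC).
    have := scale_diam (sc i) UC Cx Cc; have := metric_triangle x c y.
    rewrite (metric_sym c y); lra.
  apply: le_trans (le_bigmax _ _ i); apply: le_trans h.
  have M0 : M <= Num.max 0 M by rewrite le_max lexx orbT.
  apply: (le_trans M0); apply/ltW/(lt_trans (archi_boundP _)); first by rewrite le_max lexx.
  rewrite -natrX ltr_nat; apply: leq_trans (ltn_expl q (ltnSn 1)) _.
  by rewrite leq_exp2l // -addnn leq_addr.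
exists phi, id; split=> //; first exact: id_control.
move=> x y; apply/andP; split; first by apply: hphi; exact: mdist_ge0.
apply: bigmax_le; first exact: mdist_ge0.
by move=> i _; apply: le_trans (limit_lip (sc i) x y) _; rewrite eps1 mul1r.
Qed.

End Main.

Theorem theorem3p5 (R : realType) (n : nat) (X : metricType R) :
  proper_space X -> asdim_le X n ->
  exists (T : 'I_n.+1 -> metricType R) (F : forall i, nat -> set (T i)),
    [/\ forall i, locally_finite_tree (T i),
        forall i, binary_regular_filtration (F i)
      & exists f : X -> (forall i, T i),
          (forall x, M_space F (f x)) /\
          large_scale_embedding (@mdist R X) (@sup_dist R n T) f].
Proof.
move=> pX aX; have [[x0 _]|X0] := pselect (exists x : X, True).
  exact: pointed_embeds x0 pX aX.
by apply: empty_embeds => x; apply: X0; exists x.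
Qed.
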